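(* Let $\triangle$ be a simplicial complex on a finite vertex set $V$ and let $M_\triangle$ be its simplicial binoid. Then for all $j\ge0$ $$\mathrm H^j\left(\operatorname{Spec}^\bullet M_\triangle,\mathcal O^*_{M_\triangle}\right)\cong\bigoplus_{v\in V}\widetilde{\mathrm H}^{j-1}\left(\operatorname{lk}_\triangle(v),\mathbb Z\right),$$ where $\widetilde{\mathrm H}$ denotes reduced simplicial cohomology.
   Context: A binoid $(M,+,0,\infty)$ is a commutative monoid with an absorbing element $\infty$; $M^*$ is its group of units. An ideal is a subset $I\ni\infty$ with $M+I\subseteq I$; it is prime if $I\ne M$ and $a+b\in I$ implies $a\in I$ or $b\in I$. $\operatorname{Spec}M$ is the set of prime ideals with the topology having basis $D(f)=\{\mathfrak p\mid f\notin\mathfrak p\}$, $f\in M$. $M_+=M\setminus M^*$ is the unique maximal ideal and $\operatorname{Spec}^\bullet M=\operatorname{Spec}M\setminus\{M_+\}$. The structure sheaf $\mathcal O_M$ is the sheaf of binoids associated to $D(f)\mapsto M_f$ (localization), and $\mathcal O_M^*(U)=(\mathcal O_M(U))^*$ is the sheaf of units, a sheaf of abelian groups; it is restricted to $\operatorname{Spec}^\bullet M$. A simplicial complex $\triangle$ on $V$ is a set of subsets of $V$ closed under taking subsets and containing all singletons. $M_\triangle$ is the commutative binoid generated by $x_v$, $v\in V$, with relations $\sum_{v\in H}x_v=\infty$ for all $H\subseteq V$, $H\notin\triangle$. The link $\operatorname{lk}_\triangle(v)$ is the simplicial complex of all $G\subseteq V\setminus\{v\}$ with $G\cup\{v\}\in\triangle$.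 Reduced simplicial cohomology uses the cochain complex including degree $-1$, corresponding to the empty face; so $\widetilde{\mathrm H}^{-1}(\{\emptyset\},\mathbb Z)=\mathbb Z$. $\mathrm H^j$ on the left is sheaf cohomology; it coincides with the cohomology of the Čech complex of $\mathcal O^*_{M_\triangle}$ for the covering $\{D(x_v)\}_{v\in V}$ (the Čech-Picard complex). *)

(* Defs.v *)
From HB Require Import structures.
From mathcomp Require Import all_boot all_order all_algebra.
From mathcomp Require Import generic_quotient ring_quotient.
From mathcomp Require Import boolp classical_sets functions.
From mathcomp Require Import topology_structure subtype_topology.

Set Implicit Arguments.
Unset Strict Implicit.
Unset Printing Implicit Defensive.

Import GRing.Theory.

Local Open Scope classical_set_scope.
Local Open Scope quotient_scope.
Local Open Scope ring_scope.

Definition isomorphic (A B : zmodType) : Prop :=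
  exists f : {additive A -> B}, bijective f.

(* For a finite index type this is also the direct sum. *)
Definition dprod (I : Type) (A : I -> zmodType) : Type := forall i, A i.

Section DependentProduct.
Variables (I : Type) (A : I -> zmodType).

HB.instance Definition _ := Choice.on (dprod A).

Definition dprod_zero : dprod A := fun=> 0.
Definition dprod_opp (f : dprod A) : dprod A := fun i => - f i.
Definition dprod_add (f g : dprod A) : dprod A := fun i => f i + g i.

Lemma dprod_addA : associative dprod_add.
Proof. by move=> f g h; apply: functional_extensionality_dep => i; exact: addrA. Qed.
Lemma dprod_addC : commutative dprod_add.
Proof. by move=> f g; apply: functional_extensionality_dep => i; exact: addrC. Qed.
Lemma dprod_add0 : left_id dprod_zero dprod_add.
Proof. by move=> f; apply: functional_extensionality_dep => i; exact: add0r. Qed.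
Lemma dprod_addN : left_inverse dprod_zero dprod_opp dprod_add.
Proof. by move=> f; apply: functional_extensionality_dep => i; exact: addNr. Qed.

HB.instance Definition _ := GRing.isZmodule.Build (dprod A)
  dprod_addA dprod_addC dprod_add0 dprod_addN.

End DependentProduct.

Definition direct_sum (I : finType) (A : I -> zmodType) : zmodType := dprod A.

Section Homology.
Variables (A B C : zmodType) (f : {additive A -> B}) (g : {additive B -> C}).

Definition in_kernel : {pred B} := fun x => g x == 0.

Lemma in_kernel_closed : zmod_closed in_kernel.
Proof.
split; first by rewrite unfold_in raddf0.
by move=> x y; rewrite !unfold_in raddfB => /eqP-> /eqP->; rewrite subr0.
Qed.

Record kernel := Kernel { kernel_val : B; kernelP : kernel_val \in in_kernel }.

HB.instance Definition _ := [isSub for kernel_val].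
HB.instance Definition _ := [Choice of kernel by <:].
HB.instance Definition _ :=
  GRing.SubChoice_isSubZmodule.Build B in_kernel kernel in_kernel_closed.

Definition in_image : {pred kernel} :=
  fun x => `[< exists y, f y = kernel_val x >].

Lemma in_image_closed : zmod_closed in_image.
Proof.
split; first by apply/asboolP; exists 0; rewrite raddf0 -(raddf0 (val : kernel -> B)).
move=> x y /asboolP[a ha] /asboolP[b hb]; apply/asboolP; exists (a - b).
by rewrite raddfB ha hb -(raddfB (val : kernel -> B)).
Qed.
HB.instance Definition _ := GRing.isZmodClosed.Build kernel in_image in_image_closed.

(* [ker g / (im f :&: ker g)], which is [ker g / im f] in a complex. *)
Definition homology : zmodType := Quotient.quot in_image.

End Homology.

Record opens (X : topologicalType) := Opens {
  opens_set :> set X;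
  opensP : open opens_set
}.

Definition opensT (X : topologicalType) : opens X := Opens (@openT X).
Definition opensI (X : topologicalType) (U V : opens X) : opens X :=
  Opens (openI (opensP U) (opensP V)).

Lemma opensIl (X : topologicalType) (U V : opens X) : opensI U V `<=` U.
Proof. by move=> x []. Qed.
Lemma opensIr (X : topologicalType) (U V : opens X) : opensI U V `<=` V.
Proof. by move=> x []. Qed.

Record presheaf (X : topologicalType) := Presheaf {
  psec :> opens X -> zmodType;
  pres : forall U V : opens X, V `<=` U -> {additive psec U -> psec V};
  pres_id : forall (U : opens X) (h : U `<=` U) s, pres h s = s;
  pres_comp : forall (U V W : opens X) (hVU : V `<=` U) (hWV : W `<=` V)
    (hWU : W `<=` U) s, pres hWV (pres hVU s) = pres hWU s
}.

Lemma pres_irr (X : topologicalType) (F : presheaf X) (U V : opens X)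
  (h h' : V `<=` U) s : pres F h s = pres F h' s.
Proof. by rewrite (Prop_irrelevance h h'). Qed.

Definition is_sheaf (X : topologicalType) (F : presheaf X) : Prop :=
  forall (I : Type) (U : I -> opens X) (W : opens X) (hU : forall i, U i `<=` W)
    (s : forall i, F (U i)),
  W `<=` \bigcup_i U i ->
  (forall i k (T : opens X) (hi : T `<=` U i) (hk : T `<=` U k),
    pres F hi (s i) = pres F hk (s k)) ->
  exists! t : F W, forall i, pres F (hU i) t = s i.

Record sheaf (X : topologicalType) := Sheaf {
  sheaf_presheaf :> presheaf X;
  sheafP : is_sheaf sheaf_presheaf
}.

Section Stalk.
Variables (X : topologicalType) (F : presheaf X) (x : X).

Record pregerm := Pregerm {
  pg_dom : opens X;
  pg_in : opens_set pg_dom x;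
  pg_sec : F pg_dom
}.

HB.instance Definition _ := gen_eqMixin pregerm.
HB.instance Definition _ := gen_choiceMixin pregerm.

Definition germ_eq (s t : pregerm) : Prop :=
  exists (W : opens X) (hs : W `<=` pg_dom s) (ht : W `<=` pg_dom t),
    opens_set W x /\ pres F hs (pg_sec s) = pres F ht (pg_sec t).

Definition germ_eqb (s t : pregerm) : bool := `[< germ_eq s t >].

Lemma germ_eqb_equiv : equiv_class_of germ_eqb.
Proof.
split=> [s|s t|t s u].
- by apply/asboolP; exists (pg_dom s), (fun _ h => h), (fun _ h => h); split=> //; exact: pg_in.
- by apply/asboolP/asboolP => -[W [h1 [h2 [Wx e]]]]; exists W, h2, h1.
move=> /asboolP[W [h1 [h2 [Wx e]]]] /asboolP[W' [h1' [h2' [Wx' e']]]].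
apply/asboolP.
have hW : opensI W W' `<=` W by move=> y [].
have hW' : opensI W W' `<=` W' by move=> y [].
exists (opensI W W'), (subset_trans hW h1), (subset_trans hW' h2'); split=> //.
rewrite -(pres_comp h1 hW) e (pres_comp h2 hW (subset_trans hW h2)).
rewrite -(pres_comp h2' hW') -e' (pres_comp h1' hW' (subset_trans hW' h1')).
exact: pres_irr.
Qed.

Canonical germ_equivRel := EquivRelPack germ_eqb_equiv.
Canonical germ_encModRel := defaultEncModRel germ_eqb.

Definition stalk := {eq_quot germ_eqb}.
HB.instance Definition _ : EqQuotient pregerm germ_eqb stalk := EqQuotient.on stalk.
HB.instance Definition _ := Choice.on stalk.

Definition germ (U : opens X) (hx : opens_set U x) (s : F U) : stalk :=
  \pi_stalk (Pregerm hx s).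

Lemma germ_eqP U hU s U' hU' s' :
  germ_eq (@Pregerm U hU s) (@Pregerm U' hU' s') <-> germ hU s = germ hU' s'.
Proof.
rewrite /germ; split.
  by move=> e; apply/eqP; rewrite piE; apply/asboolP.
by move/eqP; rewrite piE => /asboolP.
Qed.

Lemma germ_surj (a : stalk) : exists U (hU : opens_set U x) (s : F U), a = germ hU s.
Proof.
by case e: (repr a) => [U hU s]; exists U, hU, s; rewrite /germ -e reprK.
Qed.

Lemma germ_pres (U V : opens X) (h : V `<=` U) (hU : opens_set U x) (hV : opens_set V x) (s : F U) :
  germ hV (pres F h s) = germ hU s.
Proof.
apply/germ_eqP; exists V, (fun _ h => h), h; split=> //=.
by rewrite pres_id.
Qed.

Let zero_pg : pregerm := @Pregerm (opensT X) I 0.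
Let opp_pg (s : pregerm) : pregerm := Pregerm (pg_in s) (- pg_sec s).
Let add_pg (s t : pregerm) : pregerm :=
  @Pregerm (opensI (pg_dom s) (pg_dom t)) (conj (pg_in s) (pg_in t))
    (pres F (@opensIl _ _ _) (pg_sec s) + pres F (@opensIr _ _ _) (pg_sec t)).

Definition stalk_zero : stalk := \pi_stalk zero_pg.
Definition stalk_opp (a : stalk) : stalk := \pi_stalk (opp_pg (repr a)).
Definition stalk_add (a b : stalk) : stalk := \pi_stalk (add_pg (repr a) (repr b)).

Lemma germN U (hU : opens_set U x) (s : F U) : stalk_opp (germ hU s) = germ hU (- s).
Proof.
rewrite /stalk_opp; case e: (repr _) => [U' hU' s'] /=.
have /germ_eqP[W /= [h1 [h2 [Wx E]]]] : germ hU' s' = germ hU s.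
  by rewrite [LHS]/germ -e reprK.
by apply/germ_eqP; exists W, h1, h2; split=> //=; rewrite !raddfN /= E.
Qed.

Lemma germD U (hU : opens_set U x) (s t : F U) :
  stalk_add (germ hU s) (germ hU t) = germ hU (s + t).
Proof.
rewrite /stalk_add.
case e: (repr (germ hU s)) => [U1 hU1 s1]; case e': (repr _) => [U2 hU2 s2] /=.
have /germ_eqP[W1 /= [h1 [k1 [Wx1 E1]]]] : germ hU1 s1 = germ hU s.
  by rewrite [LHS]/germ -e reprK.
have /germ_eqP[W2 /= [h2 [k2 [Wx2 E2]]]] : germ hU2 s2 = germ hU t.
  by rewrite [LHS]/germ -e' reprK.
pose W := opensI W1 W2.
have w1 : W `<=` W1 by move=> y [].
have w2 : W `<=` W2 by move=> y [].
have w12 : W `<=` opensI U1 U2 by move=> y [/h1 ? /h2 ?].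
apply/germ_eqP; exists W, w12, (subset_trans w1 k1); split=> //=.
rewrite !raddfD /= (pres_comp _ w12 (subset_trans w1 h1)).
rewrite (pres_comp _ w12 (subset_trans w2 h2)).
rewrite -(pres_comp h1 w1) E1 (pres_comp k1 w1 (subset_trans w1 k1)).
rewrite -(pres_comp h2 w2) E2 (pres_comp k2 w2 (subset_trans w2 k2)).
by congr (_ + _); exact: pres_irr.
Qed.

Lemma germ_surj2 (a b : stalk) :
  exists U (hU : opens_set U x) (s t : F U), a = germ hU s /\ b = germ hU t.
Proof.
have [U [hU [s ->]]] := germ_surj a; have [U' [hU' [t ->]]] := germ_surj b.
exists (opensI U U'), (conj hU hU').
exists (pres F (@opensIl _ _ _) s), (pres F (@opensIr _ _ _) t).
by rewrite (germ_pres _ hU) (germ_pres _ hU').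
Qed.

Lemma stalk_zeroE U (hU : opens_set U x) : stalk_zero = germ hU 0.
Proof.
apply/germ_eqP; exists U, (fun _ _ => I), (fun _ h => h); split=> //=.
by rewrite !raddf0.
Qed.

Lemma stalk_addA : associative stalk_add.
Proof.
move=> a b c; have [U [hU [s [t [-> ->]]]]] := germ_surj2 a b.
have [U' [hU' [u ->]]] := germ_surj c.
have hI := conj hU hU' : opens_set (opensI U U') x.
rewrite -(germ_pres (@opensIl _ U U') hU hI) -(germ_pres (@opensIl _ U U') hU hI t).
by rewrite -(germ_pres (@opensIr _ U U') hU' hI) !germD addrA.
Qed.

Lemma stalk_addC : commutative stalk_add.
Proof.
by move=> a b; have [U [hU [s [t [-> ->]]]]] := germ_surj2 a b; rewrite !germD addrC.
Qed.

Lemma stalk_add0 : left_id stalk_zero stalk_add.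
Proof.
move=> a; have [U [hU [s ->]]] := germ_surj a.
by rewrite (stalk_zeroE hU) germD add0r.
Qed.

Lemma stalk_addN : left_inverse stalk_zero stalk_opp stalk_add.
Proof.
move=> a; have [U [hU [s ->]]] := germ_surj a.
by rewrite germN germD addNr (stalk_zeroE hU).
Qed.

HB.instance Definition _ := GRing.isZmodule.Build stalk
  stalk_addA stalk_addC stalk_add0 stalk_addN.

Lemma germ_is_additive U (hU : opens_set U x) : zmod_morphism (@germ U hU).
Proof. by move=> s t; rewrite -germD -germN. Qed.
HB.instance Definition _ U (hU : opens_set U x) :=
  GRing.isZmodMorphism.Build (F U) stalk (@germ U hU) (germ_is_additive hU).

End Stalk.

Section Godement.
Variables (X : topologicalType) (F : presheaf X).

Definition opens_incl (U V : opens X) (h : V `<=` U) :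
    set_type (opens_set V) -> set_type (opens_set U) :=
  fun x => SigSub (mem_set (h (val x) (set_mem (valP x)))).

Definition gode_sec (U : opens X) : zmodType :=
  dprod (fun x : set_type (opens_set U) => stalk F (val x)).

Definition gode_res (U V : opens X) (h : V `<=` U) (s : gode_sec U) : gode_sec V :=
  fun x => s (opens_incl h x).

Lemma gode_res_is_additive (U V : opens X) (h : V `<=` U) : zmod_morphism (gode_res h).
Proof. by []. Qed.
HB.instance Definition _ (U V : opens X) (h : V `<=` U) :=
  GRing.isZmodMorphism.Build (gode_sec U) (gode_sec V) (gode_res h)
    (gode_res_is_additive h).

Lemma gode_res_id (U : opens X) (h : U `<=` U) s : gode_res h s = s.
Proof.
apply: functional_extensionality_dep => -[x hx]; rewrite /gode_res /opens_incl /=.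
by congr (s (exist _ _ _)); exact: bool_irrelevance.
Qed.

Lemma gode_res_comp (U V W : opens X) (hVU : V `<=` U) (hWV : W `<=` V)
  (hWU : W `<=` U) s : gode_res hWV (gode_res hVU s) = gode_res hWU s.
Proof.
apply: functional_extensionality_dep => -[x hx]; rewrite /gode_res /opens_incl /=.
by congr (s (exist _ _ _)); exact: bool_irrelevance.
Qed.

(* The sheaf of discontinuous sections [U |-> \prod_(x in U) F_x]. *)
Definition gode : presheaf X := Presheaf gode_res_id gode_res_comp.

Definition gode_unit (U : opens X) (s : F U) : gode U :=
  fun x => germ (set_mem (valP x)) s.

Lemma gode_unit_is_additive U : zmod_morphism (@gode_unit U).
Proof.
by move=> s t; apply: functional_extensionality_dep => x; rewrite /gode_unit raddfB.
Qed.
HB.instance Definition _ U :=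
  GRing.isZmodMorphism.Build (F U) (gode U) (@gode_unit U) (@gode_unit_is_additive U).

Lemma gode_unit_res (U V : opens X) (h : V `<=` U) (s : F U) :
  gode_unit (pres F h s) = pres gode h (gode_unit s).
Proof.
apply: functional_extensionality_dep => x.
exact: germ_pres.
Qed.

Definition gode_unit_image (U : opens X) : {pred gode U} :=
  fun s => `[< exists t : F U, gode_unit t = s >].

Lemma gode_unit_image_closed U : zmod_closed (@gode_unit_image U).
Proof.
split; first by apply/asboolP; exists 0; rewrite raddf0.
move=> x y /asboolP[a <-] /asboolP[b <-]; apply/asboolP.
by exists (a - b); rewrite raddfB.
Qed.
HB.instance Definition _ U :=
  GRing.isZmodClosed.Build (gode U) (@gode_unit_image U) (@gode_unit_image_closed U).

Definition coker_sec (U : opens X) : zmodType := Quotient.quot (@gode_unit_image U).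

Definition coker_pi (U : opens X) (s : gode U) : coker_sec U := \pi s.

Lemma coker_pi_is_additive U : zmod_morphism (@coker_pi U).
Proof. by move=> s t; rewrite /coker_pi raddfB. Qed.
HB.instance Definition _ U := GRing.isZmodMorphism.Build (gode U) (coker_sec U)
  (@coker_pi U) (@coker_pi_is_additive U).

Lemma coker_pi_eq U (s t : gode U) :
  (exists a : F U, gode_unit a = s - t) <-> coker_pi s = coker_pi t.
Proof.
by split=> [h|/eqP]; [apply/eqP; rewrite -Quotient.idealrBE; apply/asboolP
                     | rewrite -Quotient.idealrBE => /asboolP].
Qed.

Definition coker_res (U V : opens X) (h : V `<=` U) (s : coker_sec U) : coker_sec V :=
  coker_pi (pres gode h (repr s)).

Lemma coker_resE (U V : opens X) (h : V `<=` U) (s : gode U) :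
  coker_res h (coker_pi s) = coker_pi (pres gode h s).
Proof.
apply/coker_pi_eq.
have /coker_pi_eq[a e] : coker_pi (repr (coker_pi s)) = coker_pi s by exact: reprK.
by exists (pres F h a); rewrite gode_unit_res e raddfB.
Qed.

Lemma coker_pi_surj U (s : coker_sec U) : exists t, s = coker_pi t.
Proof. by exists (repr s); rewrite /coker_pi reprK. Qed.

Lemma coker_res_is_additive (U V : opens X) (h : V `<=` U) : zmod_morphism (coker_res h).
Proof.
move=> x y; have [s ->] := coker_pi_surj x; have [t ->] := coker_pi_surj y.
by rewrite -raddfB !coker_resE !raddfB.
Qed.
HB.instance Definition _ (U V : opens X) (h : V `<=` U) :=
  GRing.isZmodMorphism.Build (coker_sec U) (coker_sec V) (coker_res h)
    (coker_res_is_additive h).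

Lemma coker_res_id (U : opens X) (h : U `<=` U) s : coker_res h s = s.
Proof. by have [t ->] := coker_pi_surj s; rewrite coker_resE pres_id. Qed.

Lemma coker_res_comp (U V W : opens X) (hVU : V `<=` U) (hWV : W `<=` V)
  (hWU : W `<=` U) s : coker_res hWV (coker_res hVU s) = coker_res hWU s.
Proof.
by have [t ->] := coker_pi_surj s; rewrite !coker_resE (pres_comp hVU hWV hWU).
Qed.

(* The presheaf cokernel of [F -> gode F]. It is not sheafified: the next term
   of the resolution depends only on its stalks. *)
Definition gode_coker : presheaf X := Presheaf coker_res_id coker_res_comp.

End Godement.

Fixpoint gode_iter (X : topologicalType) (F : presheaf X) (n : nat) : presheaf X :=
  if n is n'.+1 then gode_coker (gode_iter F n') else F.

Section SheafCohomology.
Variables (X : topologicalType) (F : presheaf X).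

Definition gode_cochain (n : nat) : zmodType := gode (gode_iter F n) (opensT X).

Definition gode_d (n : nat) : gode_cochain n -> gode_cochain n.+1 :=
  fun s => @gode_unit X (gode_iter F n.+1) (opensT X) (coker_pi s).

Lemma gode_d_is_additive n : zmod_morphism (@gode_d n).
Proof. by move=> s t; rewrite /gode_d 2!raddfB. Qed.
HB.instance Definition _ n :=
  GRing.isZmodMorphism.Build (gode_cochain n) (gode_cochain n.+1) (@gode_d n)
    (@gode_d_is_additive n).

(* Cohomology of the global sections of Godement's canonical flasque resolution
   [gode (gode_iter F 0) -> gode (gode_iter F 1) -> ...]. *)
Definition presheaf_cohomology (j : nat) : zmodType :=
  if j is j'.+1 then homology (@gode_d j') (@gode_d j'.+1)
  else homology (\0 : gode_cochain 0 -> gode_cochain 0) (@gode_d 0).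

End SheafCohomology.

Definition sheaf_cohomology (X : topologicalType) (F : sheaf X) (j : nat) : zmodType :=
  presheaf_cohomology F j.

Section Restriction.
Variables (X : topologicalType) (A : opens X) (F : sheaf X).

Let Y : topologicalType := set_type (opens_set A).

Lemma image_open (W : set Y) : open W -> open (val @` W : set X).
Proof.
move=> [V oV <-].
suff -> : val @` (set_val @^-1` V : set Y) = V `&` A by apply: openI oV (opensP A).
apply/seteqP; split=> [_ [y Vy <-]|x [Vx Ax]].
  by split; [rewrite -set_valE|exact: set_mem (valP y)].
by exists (SigSub (mem_set Ax)); rewrite //= set_valE.
Qed.

Definition opens_image (W : opens Y) : opens X := Opens (image_open (opensP W)).

Lemma opens_imageS (W W' : opens Y) : W' `<=` W -> opens_image W' `<=` opens_image W.
Proof. by move=> h _ [y /h ? <-]; exists y. Qed.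

Lemma restrict_id (U : opens Y) (h : U `<=` U) s :
  pres F (opens_imageS h) s = s.
Proof. exact: pres_id. Qed.

Lemma restrict_comp (U V W : opens Y) (hVU : V `<=` U) (hWV : W `<=` V)
    (hWU : W `<=` U) s :
  pres F (opens_imageS hWV) (pres F (opens_imageS hVU) s) = pres F (opens_imageS hWU) s.
Proof. exact: pres_comp. Qed.

Definition restrict_presheaf : presheaf Y := Presheaf restrict_id restrict_comp.

Lemma restrict_is_sheaf : is_sheaf restrict_presheaf.
Proof.
move=> I U W hU s cov glue.
apply: (sheafP (s := F) (U := fun i => opens_image (U i)) (W := opens_image W)
  (fun i => opens_imageS (hU i))).
  by move=> _ [y /cov [i _ Uy] <-]; exists i => //; exists y.
move=> i k T hi hk.
pose T' : opens Y := Opens (openI (opensP (U i)) (opensP (U k))).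
have hi' : T' `<=` U i by move=> ? [].
have hk' : T' `<=` U k by move=> ? [].
have hT : T `<=` opens_image T'.
  move=> x Tx; have [y Uy e] := hi _ Tx; have [z Uz e'] := hk _ Tx.
  by exists y => //; split=> //; rewrite (_ : y = z) //; apply: val_inj; rewrite e e'.
have := glue i k T' hi' hk'.
move=> /(congr1 (pres F hT)) /=.
rewrite (pres_comp _ hT hi) (pres_comp _ hT hk); exact.
Qed.

Definition restrict_sheaf : sheaf Y := Sheaf restrict_is_sheaf.

End Restriction.

HB.mixin Record Nmodule_isBinoid M of GRing.Nmodule M := {
  infty : M;
  addr_infty : forall a : M, a + infty = infty
}.

#[short(type="binoidType")]
HB.structure Definition Binoid := {M of GRing.Nmodule M & Nmodule_isBinoid M}.

Lemma addr_inftyl (M : binoidType) (a : M) : infty + a = infty.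
Proof. by rewrite addrC addr_infty. Qed.

Definition is_unit (M : nmodType) (a : M) : Prop := exists b, a + b = 0.

Section UnitGroup.
Variable M : nmodType.

Record unit_group := UnitElt { unit_val : M; unitP : is_unit unit_val }.

Lemma unit_val_inj : injective unit_val.
Proof. by move=> [a ha] [b hb] /= e; subst b; congr UnitElt; exact: Prop_irrelevance. Qed.

HB.instance Definition _ := gen_eqMixin unit_group.
HB.instance Definition _ := gen_choiceMixin unit_group.

Lemma unit0 : is_unit (0 : M). Proof. by exists 0; rewrite addr0. Qed.

Lemma unitD (a b : M) : is_unit a -> is_unit b -> is_unit (a + b).
Proof. by move=> [c hc] [d hd]; exists (c + d); rewrite addrACA hc hd addr0. Qed.

Lemma unit_oppP (a : unit_group) : exists b : unit_group, unit_val b + unit_val a = 0.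
Proof.
have [b hb] := unitP a; have hb' : is_unit b by exists (unit_val a); rewrite addrC.
by exists (UnitElt hb'); rewrite addrC.
Qed.

Definition unit_zero : unit_group := UnitElt unit0.
Definition unit_add (a b : unit_group) : unit_group := UnitElt (unitD (unitP a) (unitP b)).
Definition unit_opp (a : unit_group) : unit_group := projT1 (cid (unit_oppP a)).

Lemma unit_addA : associative unit_add.
Proof. by move=> a b c; apply: unit_val_inj; exact: addrA. Qed.
Lemma unit_addC : commutative unit_add.
Proof. by move=> a b; apply: unit_val_inj; exact: addrC. Qed.
Lemma unit_add0 : left_id unit_zero unit_add.
Proof. by move=> a; apply: unit_val_inj; exact: add0r. Qed.
Lemma unit_addN : left_inverse unit_zero unit_opp unit_add.
Proof. by move=> a; apply: unit_val_inj; rewrite /unit_opp; case: cid. Qed.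

HB.instance Definition _ := GRing.isZmodule.Build unit_group
  unit_addA unit_addC unit_add0 unit_addN.

End UnitGroup.

Section UnitMap.
Variables (M N : nmodType) (f : {additive M -> N}).

Lemma map_is_unit (a : M) : is_unit a -> is_unit (f a).
Proof. by move=> [b e]; exists (f b); rewrite -raddfD e raddf0. Qed.

Definition unit_map (a : unit_group M) : unit_group N := UnitElt (map_is_unit (unitP a)).

Lemma unit_map_is_additive : zmod_morphism unit_map.
Proof.
have hD : {morph unit_map : a b / a + b >-> a + b}.
  by move=> a b; apply: unit_val_inj; exact: raddfD.
by move=> a b; apply: (addIr (unit_map b)); rewrite -hD !subrK.
Qed.
HB.instance Definition _ := GRing.isZmodMorphism.Build (unit_group M) (unit_group N)
  unit_map unit_map_is_additive.

End UnitMap.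

Section Localization.
Variables (M : binoidType) (S : addrClosed M).

Definition fraction : Type := M * {s : M | s \in S}.
HB.instance Definition _ := Choice.on fraction.

Definition frac_eq (x y : fraction) : Prop :=
  exists2 u, u \in S & x.1 + val y.2 + u = y.1 + val x.2 + u.

Definition frac_eqb (x y : fraction) : bool := `[< frac_eq x y >].

Lemma frac_eqb_equiv : equiv_class_of frac_eqb.
Proof.
split=> [x|x y|y x z].
- by apply/asboolP; exists 0; rewrite ?rpred0.
- by apply/asboolP/asboolP => -[u Su e]; exists u.
move=> /asboolP[u Su e] /asboolP[v Sv e']; apply/asboolP.
exists (val y.2 + u + v); first by rewrite !rpredD ?(valP y.2).
have E1 (a b c d f : M) : a + b + (c + d + f) = a + c + d + (b + f).
  by rewrite -[a + b + _]addrA (addrCA b) -[a + c + d]addrA -[RHS]addrA.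
have E2 (a b c d f : M) : a + b + c + (d + f) = a + d + f + (b + c).
  by rewrite -(addrA a b) -(addrA a d) addrAC.
by rewrite E1 e E2 e' -E1 (addrAC _ v).
Qed.

Canonical frac_equivRel := EquivRelPack frac_eqb_equiv.
Canonical frac_encModRel := defaultEncModRel frac_eqb.

Definition localization := {eq_quot frac_eqb}.
HB.instance Definition _ : EqQuotient fraction frac_eqb localization :=
  EqQuotient.on localization.
HB.instance Definition _ := Choice.on localization.

(* The fraction [a - s]. *)
Definition mkfrac (a s : M) (Ss : s \in S) : localization :=
  \pi_localization (a, exist _ s Ss).

Lemma mkfracP a s Ss b t St :
  (exists2 u, u \in S & a + t + u = b + s + u) <-> @mkfrac a s Ss = @mkfrac b t St.
Proof.
rewrite /mkfrac; split.
  by move=> h; apply/eqP; rewrite piE; apply/asboolP.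
by move/eqP; rewrite piE => /asboolP.
Qed.

Lemma mkfrac_surj (x : localization) : exists a s Ss, x = @mkfrac a s Ss.
Proof. by case e: (repr x) => [a [s Ss]]; exists a, s, Ss; rewrite /mkfrac -e reprK. Qed.

Definition loc_zero : localization := mkfrac 0 (rpred0 S).
Definition loc_infty : localization := mkfrac infty (rpred0 S).
Definition loc_add (x y : localization) : localization :=
  mkfrac ((repr x).1 + (repr y).1) (rpredD (valP (repr x).2) (valP (repr y).2)).

Lemma mkfracD a s Ss b t St (Sst : s + t \in S) :
  loc_add (@mkfrac a s Ss) (@mkfrac b t St) = mkfrac (a + b) Sst.
Proof.
rewrite /loc_add.
case e: (repr (mkfrac a Ss)) => [a' [s' Ss']]; case e': (repr _) => [b' [t' St']].
have /mkfracP[u Su E] : mkfrac a' Ss' = mkfrac a Ss by rewrite [LHS]/mkfrac -e reprK.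
have /mkfracP[v Sv E'] : mkfrac b' St' = mkfrac b St by rewrite [LHS]/mkfrac -e' reprK.
apply/mkfracP => /=; exists (u + v); first by rewrite rpredD.
by rewrite (addrACA a') (addrACA _ _ u) E E' addrACA [a + b + _]addrACA.
Qed.

Lemma loc_addA : associative loc_add.
Proof.
move=> x y z; have [a [s [Ss ->]]] := mkfrac_surj x.
have [b [t [St ->]]] := mkfrac_surj y; have [c [u [Su ->]]] := mkfrac_surj z.
have h1 := rpredD Ss St; have h2 := rpredD St Su.
rewrite (mkfracD _ _ _ _ h1) (mkfracD _ _ _ _ h2).
rewrite (mkfracD _ _ _ _ (rpredD Ss h2)) (mkfracD _ _ _ _ (rpredD h1 Su)).
by apply/mkfracP; exists 0; rewrite ?rpred0 // !addrA.
Qed.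

Lemma loc_addC : commutative loc_add.
Proof.
move=> x y; have [a [s [Ss ->]]] := mkfrac_surj x.
have [b [t [St ->]]] := mkfrac_surj y.
rewrite (mkfracD _ _ _ _ (rpredD Ss St)) (mkfracD _ _ _ _ (rpredD St Ss)).
by apply/mkfracP; exists 0; rewrite ?rpred0 // (addrC a b) (addrC s t).
Qed.

Lemma loc_add0 : left_id loc_zero loc_add.
Proof.
move=> x; have [a [s [Ss ->]]] := mkfrac_surj x.
rewrite (mkfracD _ _ _ _ (rpredD (rpred0 S) Ss)).
by apply/mkfracP; exists 0; rewrite ?rpred0 // !add0r.
Qed.

HB.instance Definition _ := GRing.isNmodule.Build localization loc_addA loc_addC loc_add0.

Lemma loc_add_infty (x : localization) : x + loc_infty = loc_infty.
Proof.
have [a [s [Ss ->]]] := mkfrac_surj x.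
rewrite [LHS](mkfracD _ _ _ _ (rpredD Ss (rpred0 S))).
by apply/mkfracP; exists 0; rewrite ?rpred0 // addr_infty !addr_inftyl.
Qed.
HB.instance Definition _ := Nmodule_isBinoid.Build localization loc_add_infty.

End Localization.

Section LocalizationMap.
Variables (M : binoidType) (S T : addrClosed M) (sub : {subset S <= T}).

Definition loc_map (x : localization S) : localization T :=
  mkfrac (repr x).1 (sub (valP (repr x).2)).

Lemma loc_mapE a s (Ss : s \in S) : loc_map (mkfrac a Ss) = mkfrac a (sub Ss).
Proof.
rewrite /loc_map; case e: (repr _) => [a' [s' Ss']] /=.
have /mkfracP[u Su E] : mkfrac a' Ss' = mkfrac a Ss by rewrite [LHS]/mkfrac -e reprK.
by apply/mkfracP; exists u => //; exact: sub.
Qed.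

End LocalizationMap.

Section Spectrum.
Variable M : binoidType.

Definition is_ideal (I : set M) : Prop :=
  I infty /\ forall a b, I b -> I (a + b).

Definition is_prime (I : set M) : Prop :=
  [/\ is_ideal I, I <> setT & forall a b, I (a + b) -> I a \/ I b].

Record spec := Spec { spec_set :> set M; specP : is_prime spec_set }.

HB.instance Definition _ := gen_eqMixin spec.
HB.instance Definition _ := gen_choiceMixin spec.

Definition basicD (f : M) : set spec := [set p | ~ spec_set p f].

Lemma spec0 (p : spec) : ~ spec_set p 0.
Proof.
have [[_ hI] hT _] := specP p => p0; apply: hT; apply/seteqP; split=> // a _.
by rewrite -[a]addr0; exact: hI.
Qed.

Lemma specD (p : spec) a b : spec_set p (a + b) <-> spec_set p a \/ spec_set p b.
Proof.
have [[_ hI] _ hP] := specP p; split; first exact: hP.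
by case; [rewrite addrC|]; exact: hI.
Qed.

Lemma basicDD f g : basicD (f + g) = basicD f `&` basicD g.
Proof.
apply/seteqP; split=> p; rewrite /basicD /= specD; first by move/not_orP.
by move=> [hf hg] [].
Qed.

Lemma basicD_cover : \bigcup_(A in range basicD) A = setT.
Proof.
apply/seteqP; split=> // p _; exists (basicD 0); [by exists 0|exact: spec0].
Qed.

Lemma basicD_join (A B : set spec) p : range basicD A -> range basicD B ->
  A p -> B p -> exists C, [/\ range basicD C, C p & C `<=` A `&` B].
Proof.
move=> [f _ <-] [g _ <-] pf pg; exists (basicD (f + g)).
by rewrite basicDD; split=> //; exists (f + g) => //; exact: basicDD.
Qed.

HB.instance Definition _ := isBaseTopological.Build spec basicD_cover basicD_join.

Lemma basicD_open f : open (basicD f).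
Proof.
exists [set basicD f]; first by move=> _ ->; exists f.
by rewrite bigcup_set1.
Qed.

Lemma open_basicD (U : set spec) p : open U -> U p ->
  exists f, basicD f p /\ basicD f `<=` U.
Proof.
move=> [B BD <-] [A BA Ap]; have [f _ fA] := BD _ BA.
by exists f; rewrite fA; split=> // q Aq; exists A.
Qed.

End Spectrum.

Section StructureSheaf.
Variable M : binoidType.

Definition powers (f : M) : {pred M} := fun s => `[< exists n, s = f *+ n >].

Lemma powers_closed f : GRing.nmod_closed (powers f).
Proof.
split; first by apply/asboolP; exists 0%N.
move=> a b /asboolP[m ->] /asboolP[n ->]; apply/asboolP.
by exists (m + n)%N; rewrite mulrnDr.
Qed.
HB.instance Definition _ f := GRing.isAddClosed.Build M (powers f) (powers_closed f).

Definition outside (p : spec M) : {pred M} := fun s => `[< ~ spec_set p s >].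

Lemma outside_closed p : GRing.nmod_closed (outside p).
Proof.
split; first by apply/asboolP; exact: spec0.
by move=> a b /asboolP ha /asboolP hb; apply/asboolP; rewrite specD => -[].
Qed.
HB.instance Definition _ p := GRing.isAddClosed.Build M (outside p) (outside_closed p).

Definition loc_at_elt (f : M) : binoidType := localization (powers f).
Definition loc_at_prime (p : spec M) : binoidType := localization (outside p).

Lemma powers_outside f (p : spec M) : basicD f p -> {subset powers f <= outside p}.
Proof.
move=> pf _ /asboolP[n ->]; apply/asboolP; elim: n => [|n IH]; first exact: spec0.
by rewrite mulrS specD => -[].
Qed.

(* [M_p] is the colimit of the [M_f] with [p] in [D(f)], i.e. the stalk at [p] of
   [D(f) |-> M_f], and this is the structure map from [M_f]. *)
Definition elt_to_prime f (p : spec M) (pf : basicD f p) : loc_at_elt f -> loc_at_prime p :=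
  loc_map (powers_outside pf).

(* A section over [U] of the sheaf associated to [D(f) |-> M_f]: a family of germs
   which locally, on some [D(f)] contained in [U], comes from an element of [M_f]. *)
Definition is_section (U : set (spec M)) (s : forall p, U p -> loc_at_prime p) : Prop :=
  forall p, U p -> exists (f : M) (hU : basicD f `<=` U) (m : loc_at_elt f),
    basicD f p /\ forall q (qf : basicD f q), s q (hU q qf) = elt_to_prime qf m.

Lemma outsideP f (p : spec M) : basicD f p -> f \in outside p.
Proof. by move=> pf; apply/asboolP. Qed.

Lemma is_sectionP (U : opens (spec M)) (s : forall p, opens_set U p -> loc_at_prime p) :
  is_section s <->
  forall p, opens_set U p -> exists (a f : M), basicD f p /\
    forall q (qf : basicD f q) (qU : opens_set U q), s q qU = mkfrac a (outsideP qf).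
Proof.
split=> hs p pU.
  have [f [hU [m [pf hm]]]] := hs p pU.
  have [a [s' [Ps em]]] := mkfrac_surj m; have /asboolP[n e] := Ps.
  exists (a + f), (f *+ n.+1); split.
    rewrite mulrS basicDD; split=> //; have /asboolP := powers_outside pf Ps.
    by rewrite e.
  move=> q qf qU; have qf' : basicD f q by move: qf; rewrite mulrS basicDD => -[].
  rewrite (Prop_irrelevance qU (hU q qf')) hm em /elt_to_prime loc_mapE.
  apply/mkfracP; exists 0; rewrite ?rpred0 // e mulrS.
  by rewrite addrA.
have [a [f [pf hf]]] := hs p pU.
have [g [pg gU]] := open_basicD (opensP U) pU.
have hfg : f + g \in powers (f + g) by apply/asboolP; exists 1%N.
have hU : basicD (f + g) `<=` U by rewrite basicDD => q [_ /gU].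
exists (f + g), hU, (mkfrac (a + g) hfg); split; first by rewrite basicDD.
move=> q qf; have qf' : basicD f q by move: qf; rewrite basicDD => -[].
rewrite (hf q qf' (hU q qf)) /elt_to_prime loc_mapE.
by apply/mkfracP; exists 0; rewrite ?rpred0 // (addrC f g) addrA.
Qed.

Section Sections.
Variable U : opens (spec M).

Record sections := SectionOf {
  sec_val : forall p, opens_set U p -> loc_at_prime p;
  sec_valP : is_section sec_val
}.

HB.instance Definition _ := gen_eqMixin sections.
HB.instance Definition _ := gen_choiceMixin sections.

Lemma sections_eq (s t : sections) : (forall p pU, @sec_val s p pU = @sec_val t p pU) -> s = t.
Proof.
case: s t => [s hs] [t ht] /= e; have {}e : s = t.
  apply: functional_extensionality_dep => p; apply: functional_extensionality_dep => pU.
  exact: e.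
by subst t; rewrite (Prop_irrelevance hs ht).
Qed.

Lemma section0 : is_section (fun p (_ : opens_set U p) => 0 : loc_at_prime p).
Proof.
apply/is_sectionP => p pU; exists 0, 0; split; first exact: spec0.
by move=> q qf qU; apply/mkfracP; exists 0; rewrite ?rpred0.
Qed.

Lemma section_infty : is_section (fun p (_ : opens_set U p) => infty : loc_at_prime p).
Proof.
apply/is_sectionP => p pU; exists infty, 0; split; first exact: spec0.
by move=> q qf qU; apply/mkfracP; exists 0; rewrite ?rpred0.
Qed.

Lemma sectionD (s t : forall p, opens_set U p -> loc_at_prime p) :
  is_section s -> is_section t -> is_section (fun p pU => s p pU + t p pU).
Proof.
move=> /is_sectionP hs /is_sectionP ht; apply/is_sectionP => p pU.
have [a [f [pf hf]]] := hs p pU; have [b [g [pg hg]]] := ht p pU.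
exists (a + b), (f + g); split; first by rewrite basicDD.
move=> q qfg qU; have [qf qg] : (basicD f `&` basicD g) q by rewrite -basicDD.
by rewrite (hf q qf qU) (hg q qg qU); exact: mkfracD.
Qed.

Definition sections_zero := SectionOf section0.
Definition sections_infty := SectionOf section_infty.
Definition sections_add s t := SectionOf (sectionD (sec_valP s) (sec_valP t)).

Lemma sections_addA : associative sections_add.
Proof. by move=> r s t; apply: sections_eq => p pU; exact: addrA. Qed.
Lemma sections_addC : commutative sections_add.
Proof. by move=> s t; apply: sections_eq => p pU; exact: addrC. Qed.
Lemma sections_add0 : left_id sections_zero sections_add.
Proof. by move=> s; apply: sections_eq => p pU; exact: add0r. Qed.
HB.instance Definition _ := GRing.isNmodule.Build sections
  sections_addA sections_addC sections_add0.

Lemma sections_add_infty (s : sections) : s + sections_infty = sections_infty.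
Proof. by apply: sections_eq => p pU; exact: addr_infty. Qed.
HB.instance Definition _ := Nmodule_isBinoid.Build sections sections_add_infty.

End Sections.

Section SectionsRestriction.
Variables (U V : opens (spec M)) (h : V `<=` U).

Lemma section_res (s : sections U) : is_section (fun p (pV : opens_set V p) => sec_val s (h pV)).
Proof.
apply/is_sectionP => p pV; have /is_sectionP hs := sec_valP s.
have [a [f [pf hf]]] := hs p (h pV); exists a, f; split=> // q qf qV; exact: hf.
Qed.

Definition sections_res (s : sections U) : sections V := SectionOf (section_res s).

Lemma sections_res_is_additive : nmod_morphism sections_res.
Proof. by split=> [|s t]; apply: sections_eq. Qed.
HB.instance Definition _ := GRing.isNmodMorphism.Build (sections U) (sections V)
  sections_res sections_res_is_additive.

End SectionsRestriction.

Definition unit_res (U V : opens (spec M)) (h : V `<=` U) :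
  {additive unit_group (sections U) -> unit_group (sections V)} :=
  unit_map (sections_res h).

Lemma unit_res_id (U : opens (spec M)) (h : U `<=` U) s : unit_res h s = s.
Proof.
apply: unit_val_inj; apply: sections_eq => p pU /=.
by rewrite (Prop_irrelevance (h p pU) pU).
Qed.

Lemma unit_res_comp (U V W : opens (spec M)) (hVU : V `<=` U) (hWV : W `<=` V)
  (hWU : W `<=` U) s : unit_res hWV (unit_res hVU s) = unit_res hWU s.
Proof.
apply: unit_val_inj; apply: sections_eq => p pU /=.
by rewrite (Prop_irrelevance (hVU p (hWV p pU)) (hWU p pU)).
Qed.

Definition units_presheaf : presheaf (spec M) :=
  @Presheaf (spec M) (fun U => unit_group (sections U)) unit_res unit_res_id unit_res_comp.

Lemma sections_glue (I : Type) (U : I -> opens (spec M)) (W : opens (spec M))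
    (hU : forall i, U i `<=` W) (s : forall i, sections (U i)) :
  W `<=` \bigcup_i U i ->
  (forall i k p (pi : opens_set (U i) p) (pk : opens_set (U k) p),
    sec_val (s i) pi = sec_val (s k) pk) ->
  exists t : sections W, forall i p (pi : opens_set (U i) p),
    sec_val t (hU i p pi) = sec_val (s i) pi.
Proof.
move=> cov glue.
have pick p (pW : opens_set W p) : {i : I | opens_set (U i) p}.
  by apply: cid; have [i _ ?] := cov p pW; exists i.
pose t p (pW : opens_set W p) : loc_at_prime p :=
  sec_val (s (projT1 (pick p pW))) (projT2 (pick p pW)).
have ht : is_section t.
  apply/is_sectionP => p pW; have [i pi] := pick p pW.
  have /is_sectionP/(_ p pi)[a [f [pf hf]]] := sec_valP (s i).
  have [g [pg gU]] := open_basicD (opensP (U i)) pi.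
  exists (a + g), (f + g); split; first by rewrite basicDD.
  move=> q qfg qW; have [qf qg] : (basicD f `&` basicD g) q by rewrite -basicDD.
  rewrite /t (glue _ i q _ (gU q qg)) (hf q qf).
  by apply/mkfracP; exists 0; rewrite ?rpred0 // (addrC f g) addrA.
by exists (SectionOf ht) => i p pi; exact: glue.
Qed.

Lemma units_is_sheaf : is_sheaf units_presheaf.
Proof.
move=> I U W hU s cov glue.
have glue' (i k : I) p (pi : opens_set (U i) p) (pk : opens_set (U k) p) :
    sec_val (unit_val (s i)) pi = sec_val (unit_val (s k)) pk.
  have := glue i k (opensI (U i) (U k)) (@opensIl _ _ _) (@opensIr _ _ _).
  move=> /(congr1 (@unit_val _)) /= /(congr1 (@sec_val _)) /= e.
  have {e} := congr1 (fun h => h p (conj pi pk)) e => /=.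
  rewrite (Prop_irrelevance (opensIl _) pi) (Prop_irrelevance (opensIr _) pk).
  exact.
have glueN (i k : I) p (pi : opens_set (U i) p) (pk : opens_set (U k) p) :
    sec_val (unit_val (- s i)) pi = sec_val (unit_val (- s k)) pk.
  have E j (pj : opens_set (U j) p) :
      sec_val (unit_val (s j)) pj + sec_val (unit_val (- s j)) pj = 0.
    have := subrr (s j).
    by move=> /(congr1 (@unit_val _)) /= /(congr1 (fun r => @sec_val _ r p pj)).
  rewrite -[LHS]addr0 -(E k pk) -(glue' i k p pi pk) addrCA addrA E.
  exact: add0r.
have [t ht] := sections_glue hU cov glue'.
have [t' ht'] := sections_glue hU cov glueN.
have tU : is_unit t.
  exists t'; apply: sections_eq => p pW; have [i _ pi] := cov p pW.
  rewrite (Prop_irrelevance pW (hU i p pi)) /= ht ht'.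
  have := subrr (s i).
  by move=> /(congr1 (@unit_val _)) /= /(congr1 (fun r => @sec_val _ r p pi)).
exists (UnitElt tU); split.
  move=> i; apply: unit_val_inj; apply: sections_eq => p pi; exact: ht.
move=> r hr; apply: unit_val_inj; apply: sections_eq => p pW.
have [i _ pi] := cov p pW; rewrite (Prop_irrelevance pW (hU i p pi)) /= ht -(hr i).
by [].
Qed.

Definition units_sheaf : sheaf (spec M) := Sheaf units_is_sheaf.

Definition nonunits : set M := [set a | ~ is_unit a].

Definition punctured : set (spec M) := [set p | spec_set p <> nonunits].

Lemma prime_sub_nonunits (p : spec M) : spec_set p `<=` nonunits.
Proof.
move=> a pa [b e]; apply: (@spec0 _ p); rewrite -e specD; by left.
Qed.

Lemma punctured_open : open punctured.
Proof.
rewrite (_ : punctured = \bigcup_(f in nonunits) basicD f).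
  by apply: bigcup_open => f _; exact: basicD_open.
apply/seteqP; split=> [p hp|p [f nf pf] e]; last by apply: pf; rewrite e.
apply: contrapT => h; apply: hp; apply/seteqP; split; first exact: prime_sub_nonunits.
by move=> a na; apply: contrapT => pa; apply: h; exists a.
Qed.

Definition punctured_opens : opens (spec M) := Opens punctured_open.

Definition punctured_units : sheaf (set_type punctured) :=
  @restrict_sheaf (spec M) punctured_opens units_sheaf.

End StructureSheaf.

Section Simplicial.
Variable V : finType.

Definition simplicial_complex (D : {set {set V}}) : Prop :=
  (forall F G : {set V}, F \in D -> G \subset F -> G \in D) /\
  (forall v, [set v]%SET \in D).

Definition link (D : {set {set V}}) (v : V) : {set {set V}} :=
  [set G : {set V} | (v \notin G) && ((v |: G)%SET \in D)]%SET.

Section ReducedCohomology.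
Variable D : {set {set V}}.

(* The faces of dimension [i]; the empty face has dimension [-1]. *)
Definition face (i : int) : finType := {F : {set V} | (F \in D) && (#|F|%:Z == i + 1)}.

Definition cochain (i : int) : zmodType := {ffun face i -> int}.

(* Signs are taken with respect to the enumeration order of [V]. *)
Definition face_sign (F : {set V}) (v : V) : int :=
  (-1) ^+ #|[set w in F | (enum_rank w < enum_rank v)%N]%SET|.

(* The coboundary from degree [i] to degree [k], meaningful for [k = i + 1]. *)
Definition coboundary (i k : int) (c : cochain i) : cochain k :=
  [ffun F : face k => \sum_(v in val F)
     face_sign (val F) v * oapp c 0 (insub (val F :\ v)%SET)].

Lemma coboundary_is_additive i k : zmod_morphism (@coboundary i k).
Proof.
move=> c c'; apply/ffunP => F; rewrite !ffunE -sumrB; apply: eq_bigr => v _.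
rewrite -mulrBr; congr (_ * _).
by case: insub => [G|] /=; rewrite ?ffunE ?subr0.
Qed.
HB.instance Definition _ i k :=
  GRing.isZmodMorphism.Build (cochain i) (cochain k) (@coboundary i k)
    (@coboundary_is_additive i k).

Definition reduced_cohomology (i : int) : zmodType :=
  homology (@coboundary (i - 1) i) (@coboundary i (i + 1)).

End ReducedCohomology.

Definition free_binoid : Type := option {ffun V -> nat}.
HB.instance Definition _ := Choice.on free_binoid.

Definition fb_add (a b : free_binoid) : free_binoid :=
  if a is Some x then if b is Some y then Some (x + y) else None else None.

Lemma fb_addA : associative fb_add.
Proof. by move=> [a|] [b|] [c|] //=; rewrite addrA. Qed.
Lemma fb_addC : commutative fb_add.
Proof. by move=> [a|] [b|] //=; rewrite addrC. Qed.
Lemma fb_add0 : left_id (Some 0 : free_binoid) fb_add.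
Proof. by move=> [a|] //=; rewrite add0r. Qed.
HB.instance Definition _ := GRing.isNmodule.Build free_binoid fb_addA fb_addC fb_add0.

Lemma fb_add_infty (a : free_binoid) : a + (None : free_binoid) = None.
Proof. by case: a. Qed.
HB.instance Definition _ := Nmodule_isBinoid.Build free_binoid fb_add_infty.

Definition fb_gen (v : V) : free_binoid := Some [ffun w => (w == v) : nat].

Definition is_congruence (M : nmodType) (R : M -> M -> Prop) : Prop :=
  [/\ forall a, R a a, forall a b, R a b -> R b a,
      forall a b c, R a b -> R b c -> R a c &
      forall a b c, R a b -> R (a + c) (b + c)].

Section SimplicialBinoid.
Variable D : {set {set V}}.

(* The congruence generated by the relations [\sum_(v in H) x_v = infty], [H \notin D]. *)
Definition sb_rel (a b : free_binoid) : Prop :=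
  forall R : free_binoid -> free_binoid -> Prop, is_congruence R ->
    (forall H : {set V}, H \notin D -> R (\sum_(v in H) fb_gen v) infty) -> R a b.

Lemma sb_rel_congruence : is_congruence sb_rel.
Proof.
split=> [a|a b ab|a b c ab bc|a b c ab] R RC Rg; have [r s t d] := RC.
- exact: r.
- by apply: s; exact: ab.
- by apply: (t _ b); [exact: ab|exact: bc].
- by apply: d; exact: ab.
Qed.

Definition sb_relb (a b : free_binoid) : bool := `[< sb_rel a b >].

Lemma sb_relb_equiv : equiv_class_of sb_relb.
Proof.
have [r s t _] := sb_rel_congruence; split=> [a|a b|a b c].
- by apply/asboolP; exact: r.
- by apply/asboolP/asboolP; [exact: s|exact: s].
- by move=> /asboolP ab /asboolP bc; apply/asboolP; exact: t bc.
Qed.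

Canonical sb_equivRel := EquivRelPack sb_relb_equiv.
Canonical sb_encModRel := defaultEncModRel sb_relb.

Definition simplicial_binoid := {eq_quot sb_relb}.
HB.instance Definition _ : EqQuotient free_binoid sb_relb simplicial_binoid :=
  EqQuotient.on simplicial_binoid.
HB.instance Definition _ := Choice.on simplicial_binoid.

Definition sb_pi (a : free_binoid) : simplicial_binoid := \pi a.

Lemma sb_piP a b : sb_rel a b <-> sb_pi a = sb_pi b.
Proof.
rewrite /sb_pi; split; first by move=> h; apply/eqP; rewrite piE; apply/asboolP.
by move/eqP; rewrite piE => /asboolP.
Qed.

Lemma sb_piK (x : simplicial_binoid) : sb_pi (repr x) = x.
Proof. exact: reprK. Qed.

Definition sb_zero : simplicial_binoid := sb_pi 0.
Definition sb_add (x y : simplicial_binoid) : simplicial_binoid := sb_pi (repr x + repr y).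

Lemma sb_piD a b : sb_add (sb_pi a) (sb_pi b) = sb_pi (a + b).
Proof.
have [_ _ t d] := sb_rel_congruence; apply/sb_piP.
have /sb_piP ha : sb_pi (repr (sb_pi a)) = sb_pi a by exact: sb_piK.
have /sb_piP hb : sb_pi (repr (sb_pi b)) = sb_pi b by exact: sb_piK.
apply: t (d _ _ _ ha) _; rewrite addrC [a + b]addrC; exact: d.
Qed.

Lemma sb_addA : associative sb_add.
Proof.
by move=> x y z; rewrite -[x]sb_piK -[y]sb_piK -[z]sb_piK !sb_piD addrA.
Qed.
Lemma sb_addC : commutative sb_add.
Proof. by move=> x y; rewrite -[x]sb_piK -[y]sb_piK !sb_piD addrC. Qed.
Lemma sb_add0 : left_id sb_zero sb_add.
Proof. by move=> x; rewrite -[x]sb_piK sb_piD add0r. Qed.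
HB.instance Definition _ := GRing.isNmodule.Build simplicial_binoid
  sb_addA sb_addC sb_add0.

Lemma sb_add_infty (x : simplicial_binoid) : x + sb_pi infty = sb_pi infty.
Proof. by rewrite -[x]sb_piK [LHS]sb_piD addr_infty. Qed.
HB.instance Definition _ := Nmodule_isBinoid.Build simplicial_binoid sb_add_infty.

End SimplicialBinoid.

End Simplicial.

(* Main.v *)
Require Import Defs.
From HB Require Import structures.
From mathcomp Require Import all_boot all_order all_algebra.
From mathcomp Require Import generic_quotient ring_quotient.
From mathcomp Require Import boolp classical_sets.
From mathcomp Require Import topology_structure subtype_topology.

Set Implicit Arguments.
Unset Strict Implicit.
Unset Printing Implicit Defensive.

Import GRing.Theory.

Local Open Scope classical_set_scope.
Local Open Scope quotient_scope.
Local Open Scope ring_scope.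

(* The points of the punctured spectrum are the nonempty faces, and the stars
   [D(x_v)] form a cover such that every nonempty intersection [D(x_H)], [H] a face,
   has a point whose only neighbourhood inside it is all of [D(x_H)]. Hence in the
   double complex formed by the Cech complexes of the terms of Godement's resolution,
   the columns are exact except the one of global sections; the rows are exact except
   that of the sheaf itself, since over a point [x] they are cochain complexes of the
   full simplex on [{v | x in D(x_v)}]. Climbing the staircase identifies sheaf
   cohomology with Cech cohomology. Finally [O^*(D(x_H)) = Z^H], so a Cech cochain
   assigns an integer to each pair [v \in H], that is, to each face [H :\ v] of the
   link of [v]; up to signs the Cech differential is the coboundary of the links. *)

(** * Subquotients *)

(* [Z / (I :&: Z)] and [Z' / (I' :&: Z')] are identified by an additive relation;
   this lets one compose isomorphisms of subquotients without forming quotients. *)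
Definition subquot_iso (A B : zmodType) (Z I : A -> Prop) (Z' I' : B -> Prop) : Prop :=
  exists R : A -> B -> Prop,
  [/\ forall x y x' y', R x y -> R x' y' -> R (x - x') (y - y'),
      forall x, Z x -> exists2 y, Z' y & R x y,
      forall y, Z' y -> exists2 x, Z x & R x y &
      forall x y, Z x -> Z' y -> R x y -> (I x <-> I' y)].

Lemma subquot_iso_sym (A B : zmodType) (Z I : A -> Prop) (Z' I' : B -> Prop) :
  subquot_iso Z I Z' I' -> subquot_iso Z' I' Z I.
Proof.
move=> [R [Rsub Rl Rr RI]]; exists (fun y x => R x y); split=> //.
  by move=> *; exact: Rsub.
by move=> y x Zy Zx /RI => /(_ Zx Zy) [h h']; split.
Qed.

(** The intermediate element is required to lie in [Z'], since only there can [I] and [I2] be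
    compared through [I']; the closure hypothesis keeps differences in [Z']. *)
Lemma subquot_iso_trans (A B C : zmodType) (Z I : A -> Prop) (Z' I' : B -> Prop)
    (Z2 I2 : C -> Prop) :
  (forall x y, Z' x -> Z' y -> Z' (x - y)) ->
  subquot_iso Z I Z' I' -> subquot_iso Z' I' Z2 I2 -> subquot_iso Z I Z2 I2.
Proof.
move=> ZB [R [Rsub Rl Rr RI]] [S [Ssub Sl Sr SI]].
exists (fun x z => exists y, [/\ Z' y, R x y & S y z]); split.
- move=> x z x' z' [y [hy hR hS]] [y' [hy' hR' hS']].
  by exists (y - y'); split; [exact: ZB|exact: Rsub|exact: Ssub].
- move=> x /Rl [y Zy hR]; have [z Zz hS] := Sl y Zy.
  by exists z => //; exists y.
- move=> z /Sr [y Zy hS]; have [x Zx hR] := Rr y Zy.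
  by exists x => //; exists y.
- move=> x z Zx Zz [y [Zy hR hS]].
  have [a b] := RI x y Zx Zy hR; have [c d] := SI y z Zy Zz hS.
  by split=> [/a /c|/d /b].
Qed.

(** With both subgroups trivial the relation is the graph of a bijection: two partners of one
    element differ by a partner of [x - x = 0], hence by 0. *)
Lemma subquot_iso_isomorphic (A B : zmodType) :
  @subquot_iso A B (fun=> True) (fun x => x = 0) (fun=> True) (fun y => y = 0) ->
  isomorphic A B.
Proof.
move=> [R [Rsub Rl Rr RI]].
have ex x : {y : B | R x y} by apply: cid; have [y _ ?] := Rl x Logic.I; exists y.
have ey y : {x : A | R x y} by apply: cid; have [x _ ?] := Rr y Logic.I; exists x.
have Rf x y y' : R x y -> R x y' -> y = y'.
  move=> h h'; apply/eqP; rewrite -subr_eq0; apply/eqP.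
  by apply/(RI (x - x) (y - y')) => //; [exact: Rsub|exact: subrr].
have Rg x x' y : R x y -> R x' y -> x = x'.
  move=> h h'; apply/eqP; rewrite -subr_eq0; apply/eqP.
  by apply/(RI (x - x') (y - y)) => //; [exact: Rsub|exact: subrr].
pose f x := projT1 (ex x); pose g y := projT1 (ey y).
have fP x : R x (f x) := projT2 (ex x).
have gP y : R (g y) y := projT2 (ey y).
have fB : zmod_morphism f by move=> x y; apply: (Rf (x - y)); [exact: fP|exact: Rsub].
pose fm := GRing.isZmodMorphism.Build A B f fB.
pose fa : {additive A -> B} := HB.pack f fm.
exists fa; exists g => [x|y] /=.
  exact: (Rg _ _ (f x)).
exact: (Rf (g y)).
Qed.

(** A homology class is related to every cycle representing it. *)
Lemma subquot_iso_homology (A B C : zmodType) (f : {additive A -> B}) (g : {additive B -> C}) :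
  @subquot_iso (homology f g) B (fun=> True) (fun x => x = 0)
    (fun x => g x = 0) (fun x => exists y, f y = x).
Proof.
exists (fun h b => exists2 k : kernel g, \pi_(homology f g) k = h & kernel_val k = b); split.
- move=> x y x' y' [k <- <-] [k' <- <-]; exists (k - k'); first by rewrite raddfB.
  exact: (raddfB (val : kernel g -> B)).
- move=> x _; exists (kernel_val (repr x)).
    by apply/eqP; exact: (kernelP (repr x)).
  by exists (repr x) => //; rewrite reprK.
- move=> y gy; have ky : y \in in_kernel g by apply/eqP.
  by exists (\pi_(homology f g) (Kernel ky)) => //; exists (Kernel ky).
- move=> x y _ gy [k <- ky].
  have -> : (\pi_(homology f g) k = 0) <-> k \in in_image f (g := g).
    rewrite -[k in X in _ <-> X]subr0 Quotient.idealrBE.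
    rewrite (_ : 0 = \pi_(homology f g) 0); last by rewrite raddf0.
    by split=> /eqP.
  by rewrite -ky unfold_in; split=> /asboolP.
Qed.

(** * The staircase between the two edges of a double complex *)

Section Staircase.
(** The horizontal degree is a predicate [gr p] rather than an index of the type, so [dh] is an
    endomorphism of [C q] and no transport between degrees arises. Exactness is assumed off row 0
    and column 0, the two edges to be compared. *)
Variables (C : nat -> zmodType) (gr : forall q, nat -> C q -> Prop).
Variables (dh : forall q, {additive C q -> C q}) (dv : forall q, {additive C q -> C q.+1}).
Hypothesis grB : forall q p (x y : C q), gr p x -> gr p y -> gr p (x - y).
Hypothesis gr_dh : forall q p (x : C q), gr p x -> gr p.+1 (dh q x).
Hypothesis gr_dv : forall q p (x : C q), gr p x -> gr p (dv q x).
Hypothesis dhh : forall q p (x : C q), gr p x -> dh q (dh q x) = 0.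
Hypothesis dvv : forall q p (x : C q), gr p x -> dv q.+1 (dv q x) = 0.
Hypothesis dvh : forall q p (x : C q), gr p x -> dv q (dh q x) = dh q.+1 (dv q x).
Hypothesis row_inj : forall q (x : C q.+1), gr 0 x -> dh q.+1 x = 0 -> x = 0.
Hypothesis row_exact : forall q p (x : C q.+1), gr p.+1 x -> dh q.+1 x = 0 ->
  exists2 y, gr p y & dh q.+1 y = x.
Hypothesis col_inj : forall p (x : C 0), gr p.+1 x -> dv 0 x = 0 -> x = 0.
Hypothesis col_exact : forall q p (x : C q.+1), gr p.+1 x -> dv q.+1 x = 0 ->
  exists2 y, gr p.+1 y & dv q y = x.

(* The intermediate subquotients of the staircase, at total degree [p + q]. *)
Let Z p q (x : C q) := gr p x /\ dh q.+1 (dv q x) = 0.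
Let I p q (x : C q) := exists y z, [/\ gr p y, dh q y = 0, dv q z = 0 & x = y + z].

Let ZB p q (x y : C q) : Z p x -> Z p y -> Z p (x - y).
Proof. by move=> [gx ex] [gy ey]; split; [exact: grB|rewrite !raddfB ex ey subrr]. Qed.

(** The zigzag [dv x = dh y]: since [dh (dv y) = 0], the element [dh y] is a vertical cycle and
    column exactness supplies [x]; conversely [dv x] is a horizontal cycle and row exactness
    supplies [y]. *)
Lemma staircase_step p q :
  subquot_iso (@Z p.+1 q.+2) (@I p.+1 q.+2) (@Z p.+2 q.+1) (@I p.+2 q.+1).
Proof.
exists (fun y x => dv q.+1 x = dh q.+2 y); split.
- by move=> y x y' x' e e'; rewrite !raddfB e e'.
- move=> y [gy ey].
  have [|x gx ex] := col_exact (gr_dh gy); first by rewrite (dvh gy).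
  by exists x => //; split=> //; rewrite ex (dhh gy).
- move=> x [gx ex].
  have [|y gy ey] := row_exact (gr_dv gx); first exact: ex.
  by exists y => //; split=> //; rewrite -(dvh gy) ey (dvv gx).
- move=> y x [gy ey] [gx ex] e; split=> -[a [b [ga ea eb ab]]].
    (* Writing the vertical cycle [b] as [dv z] makes [x - dh z] a vertical cycle, because
       [dv (dh z) = dh b = dh y]. *)
    have [|z gz ez] := @col_exact q.+1 p b _ eb.
      by rewrite (_ : b = y - a); [exact: grB|rewrite ab addrC addKr].
    exists (dh q.+1 z), (x - dh q.+1 z); split.
    + exact: gr_dh.
    + exact: (dhh gz).
    + by rewrite raddfB e (dvh gz) ez ab raddfD ea add0r subrr.
    + by rewrite addrC subrK.
  have [z gz ez] := row_exact ga ea.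
  exists (y - dv q.+1 z), (dv q.+1 z); split.
  + by apply: grB => //; exact: gr_dv.
  + by rewrite raddfB -(dvh gz) ez -e ab raddfD eb addr0 subrr.
  + exact: (dvv gz).
  + by rewrite subrK.
Qed.

(** The same zigzag entering from column 0; there [row_inj] takes the place of row exactness and
    upgrades [dh (dv y) = 0] to [dv y = 0]. *)
Lemma staircase_col q :
  subquot_iso (fun a : C q.+2 => gr 0 a /\ dv q.+2 a = 0)
    (fun a => exists2 b, gr 0 b & dv q.+1 b = a) (@Z 1 q.+1) (@I 1 q.+1).
Proof.
exists (fun y x => dv q.+1 x = dh q.+2 y); split.
- by move=> y x y' x' e e'; rewrite !raddfB e e'.
- move=> y [gy ey].
  have [|x gx ex] := col_exact (gr_dh gy); first by rewrite (dvh gy) ey raddf0.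
  by exists x => //; split=> //; rewrite ex (dhh gy).
- move=> x [gx ex].
  have [|y gy ey] := row_exact (gr_dv gx); first exact: ex.
  exists y => //; split=> //; apply: row_inj; first exact: gr_dv.
  by rewrite -(dvh gy) ey (dvv gx).
- move=> y x [gy ey] [gx ex] e; split=> [[z gz ez]|[a [b [ga ea eb ab]]]].
    exists (dh q.+1 z), (x - dh q.+1 z); split.
    + exact: gr_dh.
    + exact: (dhh gz).
    + by rewrite raddfB e (dvh gz) ez subrr.
    + by rewrite addrC subrK.
  have [z gz ez] := row_exact ga ea.
  exists z => //; apply/eqP; rewrite -subr_eq0; apply/eqP; apply: row_inj.
    by apply: grB => //; exact: gr_dv.
  by rewrite raddfB -(dvh gz) ez -e ab raddfD eb addr0 subrr.
Qed.

(** The same zigzag ending in row 0, where [col_inj] upgrades [dv (dh x) = 0] to [dh x = 0]. *)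
Lemma staircase_row p :
  subquot_iso (@Z p.+1 1) (@I p.+1 1) (fun c : C 0 => gr p.+2 c /\ dh 0 c = 0)
    (fun c => exists2 b, gr p.+1 b & dh 0 b = c).
Proof.
exists (fun y x => dv 0 x = dh 1 y); split.
- by move=> y x y' x' e e'; rewrite !raddfB e e'.
- move=> y [gy ey].
  have [|x gx ex] := col_exact (gr_dh gy); first by rewrite (dvh gy).
  exists x => //; split=> //; apply: col_inj (gr_dh gx) _.
  by rewrite (dvh gx) ex (dhh gy).
- move=> x [gx ex].
  have [|y gy ey] := row_exact (gr_dv gx); first by rewrite -(dvh gx) ex raddf0.
  by exists y => //; split=> //; rewrite -(dvh gy) ey (dvv gx).
- move=> y x [gy ey] [gx ex] e; split=> [[a [b [ga ea eb ab]]]|[z gz ez]].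
    have [|z gz ez] := @col_exact 0 p b _ eb.
      by rewrite (_ : b = y - a); [exact: grB|rewrite ab addrC addKr].
    exists z => //; apply/eqP; rewrite -subr_eq0; apply/eqP; apply: (@col_inj p.+1).
      by apply: grB => //; exact: gr_dh.
    by rewrite raddfB e (dvh gz) ez ab raddfD ea add0r subrr.
  exists (y - dv 0 z), (dv 0 z); split.
  + by apply: grB => //; exact: gr_dv.
  + by rewrite raddfB -(dvh gz) ez -e subrr.
  + exact: (dvv gz).
  + by rewrite subrK.
Qed.

(** The lowest degree: a single zigzag both leaves column 0 and reaches row 0. *)
Lemma staircase_corner :
  subquot_iso (fun a : C 1 => gr 0 a /\ dv 1 a = 0) (fun a => exists2 b, gr 0 b & dv 0 b = a)
    (fun c : C 0 => gr 1 c /\ dh 0 c = 0) (fun c => exists2 b, gr 0 b & dh 0 b = c).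
Proof.
exists (fun y x => dv 0 x = dh 1 y); split.
- by move=> y x y' x' e e'; rewrite !raddfB e e'.
- move=> y [gy ey].
  have [|x gx ex] := col_exact (gr_dh gy); first by rewrite (dvh gy) ey raddf0.
  exists x => //; split=> //; apply: col_inj (gr_dh gx) _.
  by rewrite (dvh gx) ex (dhh gy).
- move=> x [gx ex].
  have [|y gy ey] := row_exact (gr_dv gx); first by rewrite -(dvh gx) ex raddf0.
  exists y => //; split=> //; apply: row_inj; first exact: gr_dv.
  by rewrite -(dvh gy) ey (dvv gx).
- move=> y x [gy ey] [gx ex] e; split=> -[z gz ez]; exists z => //;
    apply/eqP; rewrite -subr_eq0; apply/eqP.
    apply: (@col_inj 0); first by apply: grB => //; exact: gr_dh.
    by rewrite raddfB (dvh gz) ez e subrr.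
  apply: row_inj; first by apply: grB => //; exact: gr_dv.
  by rewrite raddfB -(dvh gz) ez e subrr.
Qed.

Lemma double_complex_edges j :
  subquot_iso (fun a : C j.+1 => gr 0 a /\ dv j.+1 a = 0)
    (fun a => exists2 b, gr 0 b & dv j b = a)
    (fun c : C 0 => gr j.+1 c /\ dh 0 c = 0) (fun c => exists2 b, gr j b & dh 0 b = c).
Proof.
case: j => [|q]; first exact: staircase_corner.
apply: (subquot_iso_trans (@ZB 1 q.+1) (staircase_col q)).
(* Each step raises [p] and lowers [q] by one, so the induction on [q] runs for all [p] with the sum
   [p + q] as invariant. *)
suff H : forall q p, subquot_iso (@Z p.+1 q.+1) (@I p.+1 q.+1)
    (fun c : C 0 => gr (p + q).+2 c /\ dh 0 c = 0)
    (fun c => exists2 b, gr (p + q).+1 b & dh 0 b = c) by exact: (H q 0%N).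
elim=> [|{}q IH] p; first by rewrite addn0; exact: staircase_row.
apply: (subquot_iso_trans (@ZB p.+2 q.+1) (staircase_step p q)).
by rewrite -addSnnS; exact: IH.
Qed.

End Staircase.

(** * Cochains of a simplex *)

Section SimplexCochains.
Variable V : finType.
Implicit Types (H : {set V}) (v w : V).

Lemma face_sign_sqr H v : face_sign H v * face_sign H v = 1.
Proof. by rewrite /face_sign -signr_odd; case: odd; rewrite ?expr0 ?expr1 ?mulrNN mulr1. Qed.

Lemma face_sign_setD1 H v w : w \in H ->
  face_sign H v = (-1) ^+ (enum_rank w < enum_rank v)%N * face_sign (H :\ w)%SET v.
Proof.
move=> wH; rewrite /face_sign -exprD; congr (_ ^+ _).
rewrite (cardsD1 w) !inE wH /=; congr (_ + _)%N; apply: eq_card => u.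
by rewrite !inE andbA.
Qed.

(** Removing the earlier of the two vertices shifts the position of the later one, and not
    conversely, so exactly one sign changes. *)
Lemma face_sign_swap H v w : v \in H -> w \in H -> v != w ->
  face_sign H v * face_sign (H :\ v)%SET w = - (face_sign H w * face_sign (H :\ w)%SET v).
Proof.
move=> vH wH vw; rewrite (face_sign_setD1 v wH) (face_sign_setD1 w vH).
have : enum_rank v != enum_rank w by rewrite (inj_eq enum_rank_inj).
rewrite -val_eqE /=; case: ltngtP => // _ _; rewrite !expr0 !expr1 !mulN1r !mul1r ?opprK.
  by rewrite mulNr mulrC.
by rewrite mulNr opprK mulrC.
Qed.

(** The sign comparison behind [to_link_d]: twisting by the sign of [v] in [v |: G] turns the
    incidence signs of [v |: G] into minus those of [G]. *)
Lemma face_sign_link (G : {set V}) v w : v \notin G -> w \in G ->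
  face_sign (v |: G)%SET w * face_sign (v |: G)%SET v =
  - (face_sign G w * face_sign ((v |: G) :\ w)%SET v).
Proof.
move=> vG wG; have wv : w != v by apply: contraNneq vG => <-.
have wvG : w \in (v |: G)%SET by rewrite !inE wG orbT.
have := face_sign_swap wvG (finset.setU11 v _) wv; rewrite finset.setU1K // => /esym/eqP.
rewrite eqr_oppLR => /eqP swap.
rewrite -[LHS]mulr1 -(face_sign_sqr G w) mulrA -(mulrA (face_sign _ w)) swap.
by rewrite mulrN mulrA face_sign_sqr mul1r mulNr mulrC.
Qed.

(** Pairs are split by the order of [v] and [w], and the two halves cancel. Equality of the sum with
    its own negative would not suffice, as [A] may have 2-torsion. *)
Lemma sum_antisym (A : zmodType) H (g : V -> V -> A) :
  (forall v w, v \in H -> w \in H -> v != w -> g w v = - g v w) ->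
  \sum_(v in H) \sum_(w in (H :\ v)%SET) g v w = 0.
Proof.
move=> gA; pose lt (v w : V) := (enum_rank v < enum_rank w)%N.
rewrite (eq_bigr (fun v => \sum_(w in H | lt v w) g v w +
  \sum_(w in H | lt w v) g v w)); last first.
  move=> v vH; rewrite (bigID (lt v)) /=; congr (_ + _); apply: eq_bigl => w.
    rewrite !inE; case: eqVneq => [->|_] //=.
    by rewrite /lt ltnn andbF.
  rewrite !inE /lt -(inj_eq enum_rank_inj w v) -val_eqE /=.
  by case: ltngtP => _; rewrite /= ?andbF ?andbT.
rewrite big_split /= (exchange_big_dep (mem H)) /=; last by move=> v w _ /andP[].
rewrite -big_split big1 //= => v vH.
rewrite (eq_bigl (fun w => (w \in H) && lt w v)); last by move=> w; rewrite vH.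
rewrite -big_split big1 //= => w /andP[wH lt_wv].
rewrite (gA v w) ?subrr ?addNr //.
by apply: contraTneq lt_wv => ->; rewrite /lt ltnn.
Qed.

Definition delta (A : zmodType) (f : {set V} -> A) H : A :=
  \sum_(v in H) f (H :\ v)%SET *~ face_sign H v.

Lemma eq_delta (A : zmodType) (f g : {set V} -> A) H :
  (forall v, v \in H -> f (H :\ v)%SET = g (H :\ v)%SET) -> delta f H = delta g H.
Proof. by move=> fg; apply: eq_bigr => v vH; rewrite fg. Qed.

Lemma deltaB (A : zmodType) (f g : {set V} -> A) H :
  delta (fun G => f G - g G) H = delta f H - delta g H.
Proof. by rewrite /delta -sumrB; apply: eq_bigr => v _; rewrite mulrzBl. Qed.

Lemma delta_delta (A : zmodType) (f : {set V} -> A) H : delta (delta f) H = 0.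
Proof.
rewrite /delta.
rewrite (eq_bigr (fun v => \sum_(w in (H :\ v)%SET)
  f (H :\ v :\ w)%SET *~ (face_sign H v * face_sign (H :\ v)%SET w))).
  apply: sum_antisym => v w vH wH vw.
  by rewrite (face_sign_swap vH wH vw) mulrNz opprK finset.setDDl finset.setUC -finset.setDDl.
by move=> v vH; rewrite mulrz_suml; apply: eq_bigr => w _; rewrite -mulrzA mulrC.
Qed.

(* The simplex on [S] is a cone with apex [w], hence has no reduced cohomology. *)
Definition cone (A : zmodType) w (f : {set V} -> A) H : A :=
  if w \in H then 0 else f (w |: H)%SET *~ face_sign (w |: H)%SET w.

(** For [w] in [H] only the summand removing [w] survives. Otherwise the cocycle condition on
    [w |: H] expresses [f H] through the remaining faces of [w |: H], which are those the cone
    evaluates. *)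
Lemma delta_cone (A : zmodType) w (S : {set V}) (f : {set V} -> A) : w \in S ->
  (forall H, H \subset S -> delta f H = 0) ->
  forall H, H \subset S -> delta (cone w f) H = f H.
Proof.
move=> wS df H HS; rewrite /delta /cone.
have [wH|wH] := boolP (w \in H).
  rewrite (bigD1 w) //= finset.setD11 finset.setD1K // -mulrzA face_sign_sqr mulr1z.
  rewrite big1 ?addr0 // => v /andP[vH vw].
  by rewrite !inE eq_sym vw wH mul0rz.
have wHS : (w |: H)%SET \subset S by rewrite finset.subUset finset.sub1set wS.
have wvH v : v \in H -> (w |: H :\ v)%SET = ((w |: H) :\ v)%SET.
  move=> vH; rewrite finset.setDUl (_ : [set w]%SET :\ v = [set w])%SET //.
  apply/finset.setP => u; rewrite !inE; case: eqVneq => //= ->.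
  by apply/esym/eqP => e; move: wH; rewrite -e vH.
have := congr1 (fun a => a *~ face_sign (w |: H)%SET w) (df _ wHS); rewrite mul0rz.
rewrite /delta (bigD1 w) ?setU11 //= finset.setU1K // mulrzDl -mulrzA face_sign_sqr mulr1z.
move/eqP; rewrite addr_eq0 => /eqP ->; rewrite mulrz_suml -sumrN.
apply: eq_big => [v|v vH].
  by rewrite !inE; case: eqVneq => [->|] /=; rewrite ?andbF ?andbT ?(negbTE wH).
have vw : v != w by apply: contraNneq wH => <-.
have vwH : v \in (w |: H)%SET by rewrite !inE vH orbT.
rewrite !inE (negbTE wH) andbF wvH // -!mulrzA -mulrNz; congr (_ *~ _).
have := face_sign_swap vwH (finset.setU11 w H) vw; rewrite finset.setU1K // => swap.
rewrite -[LHS]mul1r -(face_sign_sqr (w |: H)%SET v) -mulrA; rewrite -mulrN; congr (_ * _).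
by rewrite mulrA swap mulNr -mulrA face_sign_sqr mulr1.
Qed.

End SimplexCochains.

(** * Covers whose intersections have a focal point *)

Section Evaluation.
Variables (I : Type) (A : I -> zmodType) (i : I).

Definition eval_at (f : dprod A) : A i := f i.

Lemma eval_at_is_additive : zmod_morphism eval_at.
Proof. by []. Qed.
HB.instance Definition _ :=
  GRing.isZmodMorphism.Build (dprod A) (A i) eval_at eval_at_is_additive.

End Evaluation.

Section ConeCover.
Variables (X : topologicalType) (F : presheaf X) (V : finType) (D : {set {set V}}).
(* [sig x] is the set of members of the cover through [x], and [U H] is the
   intersection of the members indexed by [H]; in particular [U set0] is [X]. *)
Variables (sig : X -> {set V}) (U : {set V} -> opens X).
Hypothesis D_sub : forall H K : {set V}, H \in D -> K \subset H -> K \in D.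
Hypothesis UP : forall H x, opens_set (U H) x <-> H \subset sig x.
Hypothesis sig_neq0 : forall x, sig x != finset.set0.
Hypothesis sigD : forall x, sig x \in D.
Hypothesis focus : forall H, H \in D -> H != finset.set0 ->
  exists2 m, opens_set (U H) m & forall W : opens X, opens_set W m -> U H `<=` W.

Lemma US (H K : {set V}) : K \subset H -> U H `<=` U K.
Proof. by move=> KH x /UP Hx; apply/UP; exact: fintype.subset_trans Hx. Qed.

Lemma U_face H x : opens_set (U H) x -> H \in D.
Proof. by move/UP; exact/D_sub/sigD. Qed.

(** Every neighbourhood of the focal point contains [U H], so a germ there determines the section
    over [U H]. Being valid for all presheaves, this applies to the cokernels in Godement's
    resolution. *)
Lemma focus_germ_inj (G : presheaf X) H : H \in D -> H != finset.set0 ->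
  exists (m : X) (hm : opens_set (U H) m), forall s : G (U H), germ hm s = 0 -> s = 0.
Proof.
move=> HD H0; have [m hm mU] := focus HD H0; exists m, hm => s.
rewrite -(raddf0 (germ hm)) => /germ_eqP[W /= [h [h' [Wm e]]]].
have UW := mU W Wm.
by rewrite -(pres_id (fun x h => h) s) -(pres_comp h UW) e raddf0 raddf0.
Qed.

(** Extension by 0 outside [W] lets cochains be families over all pairs of a point and a subset,
    free of membership proofs. *)
Definition germ0 (G : presheaf X) x (W : opens X) (s : G W) : stalk G x :=
  if pselect (opens_set W x) is left h then germ h s else 0.

Lemma germ0E (G : presheaf X) x (W : opens X) (h : opens_set W x) (s : G W) :
  germ0 x s = germ h s.
Proof. by rewrite /germ0; case: pselect => // h'; rewrite (Prop_irrelevance h' h). Qed.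

Lemma germ0_out (G : presheaf X) x (W : opens X) (s : G W) :
  ~ opens_set W x -> germ0 x s = 0.
Proof. by rewrite /germ0; case: pselect. Qed.

Lemma germ0_is_additive (G : presheaf X) x (W : opens X) : zmod_morphism (@germ0 G x W).
Proof.
move=> s t; have [h|h] := pselect (opens_set W x); last by rewrite !germ0_out // subrr.
by rewrite !(germ0E h) raddfB.
Qed.
HB.instance Definition _ (G : presheaf X) x (W : opens X) :=
  GRing.isZmodMorphism.Build (G W) (stalk G x) (@germ0 G x W) (@germ0_is_additive G x W).

(* Families indexed by [x : X] and [H : {set V}]; those supported on pairs with
   [#|H| = p] and [H \subset sig x] are the Cech [(p-1)]-cochains of [gode G]. *)
Definition cech (G : presheaf X) : zmodType :=
  dprod (fun x : X => dprod (fun _ : {set V} => stalk G x)).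

Definition cech_gr (G : presheaf X) (p : nat) (c : cech G) : Prop :=
  forall x (H : {set V}), ~~ ((#|H| == p) && (H \subset sig x)) -> c x H = 0.

Definition cech_d (G : presheaf X) (c : cech G) : cech G :=
  fun x H => if H \subset sig x then delta (c x) H else 0.

Lemma cech_d_is_additive G : zmod_morphism (@cech_d G).
Proof.
move=> c c'; apply: functional_extensionality_dep => x.
apply: functional_extensionality_dep => H; rewrite /cech_d /=.
rewrite [RHS](_ : _ = cech_d c x H - cech_d c' x H) // /cech_d.
by case: ifP => _; rewrite ?subr0 -?deltaB.
Qed.
HB.instance Definition _ G :=
  GRing.isZmodMorphism.Build (cech G) (cech G) (@cech_d G) (@cech_d_is_additive G).

Definition cech_sec (G : presheaf X) (c : cech G) H : gode G (U H) :=
  fun x => c (val x) H.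
Arguments cech_sec {G} c H.

(** Godement's differential over each [U H]: project to the presheaf cokernel, then take germs. *)
Definition cech_v (G : presheaf X) (c : cech G) : cech (gode_coker G) :=
  fun x H => germ0 x (coker_pi (cech_sec c H) : gode_coker G (U H)).

Lemma cech_v_is_additive G : zmod_morphism (@cech_v G).
Proof.
move=> c c'; apply: functional_extensionality_dep => x.
apply: functional_extensionality_dep => H.
by rewrite /cech_v [cech_sec (c - c') H](_ : _ = cech_sec c H - cech_sec c' H) // !raddfB.
Qed.
HB.instance Definition _ G :=
  GRing.isZmodMorphism.Build (cech G) (cech (gode_coker G)) (@cech_v G) (@cech_v_is_additive G).

Lemma cech_grB G p (c c' : cech G) : cech_gr p c -> cech_gr p c' -> cech_gr p (c - c').
Proof.
move=> gc gc' x H h.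
by rewrite [LHS](_ : _ = c x H - c' x H) // gc // gc' // subrr.
Qed.

Lemma cech_gr_d G p (c : cech G) : cech_gr p c -> cech_gr p.+1 (cech_d c).
Proof.
move=> gc x H h; rewrite /cech_d; case: ifP => // Hx.
rewrite /delta big1 // => v vH; rewrite gc ?mul0rz //.
by move: h; rewrite Hx andbT (cardsD1 v) vH add1n eqSS => /negbTE ->.
Qed.

Lemma cech_gr_v G p (c : cech G) : cech_gr p c -> cech_gr p (cech_v c).
Proof.
move=> gc x H h; rewrite /cech_v; have [/UP Hx|] := pselect (opens_set (U H) x); last first.
  exact: germ0_out.
rewrite (_ : cech_sec c H = 0) ?raddf0 //; apply: functional_extensionality_dep => y.
by apply: gc; move: h; rewrite Hx andbT => /negbTE ->.
Qed.

Lemma cech_dd G (c : cech G) : cech_d (cech_d c) = 0.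
Proof.
apply: functional_extensionality_dep => x.
apply: functional_extensionality_dep => H; rewrite /cech_d; case: ifP => // Hx.
rewrite -[RHS](delta_delta (c x) H); apply: eq_delta => v vH.
by rewrite (fintype.subset_trans (finset.subsetDl _ _) Hx).
Qed.

Lemma cech_sec_v G (c : cech G) H :
  cech_sec (cech_v c) H = gode_unit (coker_pi (cech_sec c H) : gode_coker G (U H)).
Proof.
apply: functional_extensionality_dep => x.
exact: germ0E.
Qed.

Lemma coker_pi_unit (G : presheaf X) W (s : G W) : coker_pi (gode_unit s) = 0.
Proof.
rewrite -(raddf0 (@coker_pi _ G W)); apply/coker_pi_eq.
by exists s; rewrite subr0.
Qed.

Lemma cech_vv G (c : cech G) : cech_v (cech_v c) = 0.
Proof.
apply: functional_extensionality_dep => x.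
apply: functional_extensionality_dep => H.
by rewrite {1}/cech_v cech_sec_v coker_pi_unit raddf0.
Qed.

(** Over [U H] the Cech differential is a signed sum of restrictions from the larger opens, and both
    the projection to the cokernel and germs are compatible with restriction. *)
Lemma cech_vd G (c : cech G) : cech_v (cech_d c) = cech_d (cech_v c).
Proof.
apply: functional_extensionality_dep => x.
apply: functional_extensionality_dep => H; rewrite /cech_v {2}/cech_d.
have [Hx|nHx] := pselect (opens_set (U H) x); last first.
  rewrite germ0_out //; case: ifP => // Hx; case: nHx; exact/UP.
rewrite (iffLR (UP H x) Hx).
have UHK v : U H `<=` U (H :\ v)%SET by exact/US/finset.subsetDl.
have -> : cech_sec (cech_d c) H =
    \sum_(v in H) pres (gode G) (UHK v) (cech_sec c (H :\ v)%SET) *~ face_sign H v.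
  apply: functional_extensionality_dep => y; rewrite /cech_sec /cech_d.
  have Hy : H \subset sig (val y) by apply/UP; exact: set_mem (valP y).
  rewrite Hy -[RHS]/(eval_at y _) raddf_sum.
  by apply: eq_bigr => v _; rewrite raddfMz.
rewrite raddf_sum raddf_sum; apply: eq_bigr => v vH /=; rewrite !raddfMz; congr (_ *~ _).
rewrite [LHS](_ : _ = germ0 x (pres (gode_coker G) (UHK v) (coker_pi (cech_sec c (H :\ v)%SET)))).
  rewrite (germ0E Hx) (germ0E (UHK v _ Hx)). exact: (@germ_pres _ (gode_coker G)).
by rewrite /= coker_resE.
Qed.

(** At a singleton [[set w]] with [w] in [sig x], the differential takes the value [c x set0] up to
    sign. *)
Lemma cech_row_inj G (c : cech G) : cech_gr 0 c -> cech_d c = 0 -> c = 0.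
Proof.
move=> gc dc; apply: functional_extensionality_dep => x.
apply: functional_extensionality_dep => H.
have [|h] := boolP ((#|H| == 0) && (H \subset sig x)); last exact: gc.
rewrite cards_eq0 => /andP[/eqP-> _].
have /finset.set0Pn[w wx] := sig_neq0 x.
have := congr1 (fun c : cech G => c x [set w]%SET *~ face_sign [set w]%SET w) dc.
rewrite /cech_d finset.sub1set wx /delta big_set1 finset.setDv.
by rewrite -mulrzA face_sign_sqr mulr1z mul0rz.
Qed.

(** Sections of [gode] are arbitrary families of germs, so at each point [x] separately the simplex
    on [sig x] may be contracted to an apex [w x]. *)
Lemma cech_row_exact G p (c : cech G) : cech_gr p.+1 c -> cech_d c = 0 ->
  exists2 b, cech_gr p b & cech_d b = c.
Proof.
move=> gc dc.
have dcx x (H : {set V}) : H \subset sig x -> delta (c x) H = 0.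
  move=> Hx; have := congr1 (fun c : cech G => c x H) dc.
  by rewrite /cech_d Hx.
have /choice[w wx] : forall x, exists w, w \in sig x by move=> x; exact/finset.set0Pn.
exists (fun x (H : {set V}) => if H \subset sig x then cone (w x) (c x) H else 0).
  move=> x H; case: ifP => // Hx; rewrite andbT /cone; case: ifP => // wH h.
  by rewrite gc ?mul0rz // cardsU1 wH add1n eqSS negb_and h.
apply: functional_extensionality_dep => x.
apply: functional_extensionality_dep => H; rewrite /cech_d; case: ifP => Hx; last first.
  by rewrite gc // Hx andbF.
rewrite -[RHS](delta_cone (wx x) (dcx x) Hx); apply: eq_delta => v vH.
by rewrite (fintype.subset_trans (finset.subsetDl _ _) Hx).
Qed.

(** At the focal point of [U H] the cycle condition says that a cokernel class has zero germ; hence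
    the class vanishes on all of [U H], and the section lifts there. Degree [p.+1] makes [H]
    nonempty, as [focus] demands. *)
Lemma cech_col_exact G p (c : cech (gode_coker G)) : cech_gr p.+1 c -> cech_v c = 0 ->
  exists2 b, cech_gr p.+1 b & cech_v b = c.
Proof.
move=> gc dc.
(* Outside [D] any [s] serves, because [U H] is empty; for the wrong cardinality [s = 0] keeps the
   lift homogeneous. *)
have ex H : exists s : gode G (U H),
    if #|H| == p.+1 then H \in D -> gode_unit (coker_pi s : gode_coker G (U H)) = cech_sec c H
    else s = 0.
  case: eqP => [cH|_]; last by exists 0.
  have [HD|] := boolP (H \in D); last by exists 0.
  have H0 : H != finset.set0 by rewrite -cards_eq0 cH.
  have [m [hm inj]] := @focus_germ_inj (gode_coker (gode_coker G)) H HD H0.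
  have : coker_pi (cech_sec c H) = 0.
    apply: inj; have := congr1 (fun c : cech _ => c m H) dc.
    by rewrite /cech_v (germ0E hm).
  rewrite -(raddf0 (@coker_pi _ (gode_coker G) (U H))) => /coker_pi_eq[t].
  rewrite subr0; have [s ->] := coker_pi_surj t => e.
  by exists s.
pose s H := projT1 (cid (ex H)).
have sP H := projT2 (cid (ex H)).
pose b : cech G := fun x H =>
  if pselect (opens_set (U H) x) is left h then s H (SigSub (mem_set h)) else 0.
have bs H : cech_sec b H = s H.
  apply: functional_extensionality_dep => -[x hx]; rewrite /cech_sec /b /=.
  case: pselect => [h|[]]; last exact: set_mem.
  by congr (s H (exist _ _ _)); exact: bool_irrelevance.
exists b.
  move=> x H; rewrite /b; case: pselect => // h; rewrite (iffLR (UP H x) h) andbT.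
  by move=> /negbTE cH; have := sP H; rewrite -/(s H) cH => ->.
apply: functional_extensionality_dep => x; apply: functional_extensionality_dep => H.
rewrite /cech_v bs.
have [h|h] := pselect (opens_set (U H) x); last first.
  rewrite germ0_out // gc //; apply/negP => /andP[_ Hx]; apply: h; exact/UP.
have := sP H; rewrite -/(s H); case: eqP => [_ /(_ (U_face h)) e|cH ->]; last first.
  by rewrite !raddf0 gc // (introF eqP cH).
have := congr1 (fun t : gode (gode_coker G) (U H) => t (SigSub (mem_set h))) e.
by rewrite /cech_sec /= => <-; rewrite (germ0E h) /gode_unit; congr germ.
Qed.

(** * The Cech row of the sheaf, in integer coordinates *)

Variable theta : forall H : {set V}, {additive dprod (fun _ : V => int) -> F (U H)}.
(** On vectors supported on [H], [theta H] will be an isomorphism of [Z^H] with [F (U H)];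
    restriction from [U K] to [U H] is then the inclusion of [Z^K] into [Z^H]. *)
Hypothesis theta_res : forall (H K : {set V}) (h : U H `<=` U K) (e : dprod (fun _ : V => int)),
  K \subset H ->
  (forall v, v \notin K -> e v = 0) -> pres F h (theta K e) = theta H e.
Hypothesis theta_inj : forall (H : {set V}) (e : dprod (fun _ : V => int)),
  H \in D -> H != finset.set0 ->
  (forall v, v \notin H -> e v = 0) -> theta H e = 0 -> e = 0.
Hypothesis theta_surj : forall (H : {set V}) (t : F (U H)),
  H \in D -> H != finset.set0 ->
  exists2 e : dprod (fun _ : V => int), (forall v, v \notin H -> e v = 0) & theta H e = t.

(* Families supported on pairs [v \in H] with [H] in [D]: the Cech complex of [F]. *)
Definition aug : zmodType := dprod (fun _ : {set V} => dprod (fun _ : V => int)).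

Definition aug_gr (p : nat) (e : aug) : Prop :=
  forall (H : {set V}) v, ~~ [&& #|H| == p, H \in D & v \in H] -> e H v = 0.

(** The cut to [D] preserves the support condition of [aug_gr]; off [D] the open [U H] is empty. *)
Definition aug_d (e : aug) : aug := fun H => if H \in D then delta e H else 0.

Lemma aug_d_is_additive : zmod_morphism aug_d.
Proof.
move=> e e'; apply: functional_extensionality_dep => H.
rewrite [RHS](_ : _ = aug_d e H - aug_d e' H) // /aug_d.
by case: ifP => _; rewrite ?subr0 -?deltaB.
Qed.
HB.instance Definition _ := GRing.isZmodMorphism.Build aug aug aug_d aug_d_is_additive.

Definition aug_v (e : aug) : cech F := fun x H => germ0 x (theta H (e H)).

Lemma aug_v_is_additive : zmod_morphism aug_v.
Proof.
move=> e e'; apply: functional_extensionality_dep => x.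
apply: functional_extensionality_dep => H.
by rewrite /aug_v [(e - e') H](_ : _ = e H - e' H) // !raddfB.
Qed.
HB.instance Definition _ := GRing.isZmodMorphism.Build aug (cech F) aug_v aug_v_is_additive.

Lemma aug_grB p (e e' : aug) : aug_gr p e -> aug_gr p e' -> aug_gr p (e - e').
Proof.
move=> ge ge' H v h.
by rewrite [LHS](_ : _ = e H v - e' H v) // ge // ge' // subrr.
Qed.

Lemma aug_gr_d p (e : aug) : aug_gr p e -> aug_gr p.+1 (aug_d e).
Proof.
move=> ge H v h; rewrite /aug_d; case: ifP => // HD.
rewrite -[LHS]/(eval_at v _) raddf_sum big1 // => w wH; rewrite raddfMz.
rewrite /= /eval_at ge ?mul0rz //.
move: h; rewrite HD (cardsD1 w) wH add1n eqSS; apply: contra => /and3P[-> _].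
by rewrite !inE => /andP[].
Qed.

Lemma aug_gr_v p (e : aug) : aug_gr p e -> cech_gr p (aug_v e).
Proof.
move=> ge x H h; rewrite /aug_v; have [/UP Hx|] := pselect (opens_set (U H) x); last first.
  exact: germ0_out.
rewrite (_ : e H = 0) ?raddf0 //; apply: functional_extensionality_dep => v.
by apply: ge; move: h; rewrite Hx andbT => /negbTE ->.
Qed.

Lemma aug_dd (e : aug) : aug_d (aug_d e) = 0.
Proof.
apply: functional_extensionality_dep => H; rewrite /aug_d; case: ifP => // HD.
rewrite -[RHS](delta_delta e H); apply: eq_delta => v vH.
by rewrite (D_sub HD (finset.subsetDl _ _)).
Qed.

Lemma aug_vv (e : aug) : cech_v (aug_v e) = 0.
Proof.
apply: functional_extensionality_dep => x.
apply: functional_extensionality_dep => H; rewrite /cech_v.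
rewrite (_ : cech_sec (aug_v e) H = gode_unit (theta H (e H))).
  by rewrite coker_pi_unit raddf0.
apply: functional_extensionality_dep => y.
exact: germ0E.
Qed.

Lemma aug_vd p (e : aug) : aug_gr p e -> aug_v (aug_d e) = cech_d (aug_v e).
Proof.
move=> ge; apply: functional_extensionality_dep => x.
apply: functional_extensionality_dep => H; rewrite {1}/aug_v /cech_d.
have [Hx|nHx] := pselect (opens_set (U H) x); last first.
  rewrite germ0_out //; case: ifP => // Hx; case: nHx; exact/UP.
rewrite (iffLR (UP H x) Hx) /aug_d (U_face Hx) !raddf_sum.
have UHK v : U H `<=` U (H :\ v)%SET by exact/US/finset.subsetDl.
apply: eq_bigr => v vH; rewrite !raddfMz /=; congr (_ *~ _); rewrite /aug_v.
rewrite (germ0E Hx) (germ0E (UHK v _ Hx)) -(theta_res (UHK v)).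
- exact: germ_pres.
- exact: finset.subsetDl.
- by move=> w wH; apply: ge; rewrite (negbTE wH) !andbF.
Qed.

Lemma aug_supp p (e : aug) (H : {set V}) v : aug_gr p e -> v \notin H -> e H v = 0.
Proof. by move=> ge vH; apply: ge; rewrite (negbTE vH) !andbF. Qed.

Lemma aug_col_inj p (e : aug) : aug_gr p.+1 e -> aug_v e = 0 -> e = 0.
Proof.
move=> ge e0; apply: functional_extensionality_dep => H.
have [/andP[/eqP cH HD]|h] := boolP ((#|H| == p.+1) && (H \in D)); last first.
  apply: functional_extensionality_dep => v; apply: ge.
  by rewrite andbA (negbTE h).
have H0 : H != finset.set0 by rewrite -cards_eq0 cH.
have [m [hm inj]] := @focus_germ_inj F H HD H0.
apply: (theta_inj HD H0); first by move=> v; exact: aug_supp ge.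
apply: inj; rewrite -(germ0E hm).
exact: (congr1 (fun c : cech F => c m H) e0).
Qed.

(** As in [cech_col_exact], the focal point yields a section of [F] over the whole of [U H];
    [theta_surj] gives its coordinates. *)
Lemma aug_col_exact p (c : cech F) : cech_gr p.+1 c -> cech_v c = 0 ->
  exists2 e, aug_gr p.+1 e & aug_v e = c.
Proof.
move=> gc dc.
have ex (H : {set V}) : exists e : dprod (fun _ : V => int),
    if (#|H| == p.+1) && (H \in D) then
      (forall v, v \notin H -> e v = 0) /\ gode_unit (theta H e) = cech_sec c H
    else e = 0.
  case: andP => [[/eqP cH HD]|_]; last by exists 0.
  have H0 : H != finset.set0 by rewrite -cards_eq0 cH.
  have [m [hm inj]] := @focus_germ_inj (gode_coker F) H HD H0.
  have : coker_pi (cech_sec c H) = 0.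
    apply: inj; have := congr1 (fun c : cech _ => c m H) dc.
    by rewrite /cech_v (germ0E hm).
  rewrite -(raddf0 (@coker_pi _ F (U H))) => /coker_pi_eq[t].
  rewrite subr0; have [e e0 <-] := theta_surj t HD H0 => et.
  by exists e.
pose e : aug := fun H => projT1 (cid (ex H)).
have eP H := projT2 (cid (ex H)); rewrite -/(e _) in eP.
exists e.
  move=> H v; have := eP H; rewrite -/(e H) andbA; case: andP => [_ [e0 _]|_ -> //].
  exact: e0.
apply: functional_extensionality_dep => x; apply: functional_extensionality_dep => H.
have [h|h] := pselect (opens_set (U H) x); last first.
  rewrite /aug_v germ0_out // gc //; apply/negP => /andP[_ Hx]; apply: h; exact/UP.
have := eP H; rewrite -/(e H) (U_face h) andbT /aug_v; case: eqP => [_ [_ eH]|cH ->]; last first.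
  by rewrite !raddf0 gc // (introF eqP cH).
have := congr1 (fun t : gode F (U H) => t (SigSub (mem_set h))) eH.
by rewrite /cech_sec /= => <-; rewrite (germ0E h) /gode_unit; congr germ.
Qed.

(** Both indices are shifted by one: row 0 is the sheaf itself and row [q.+1] the Godement term [q],
    while column [p] holds the Cech degree [p - 1], so that column 0 consists of global sections. *)
Let C (q : nat) : zmodType := if q is q'.+1 then cech (gode_iter F q') else aug.

Let gr q : nat -> C q -> Prop :=
  match q return nat -> C q -> Prop with
  | 0 => aug_gr | q'.+1 => @cech_gr (gode_iter F q') end.

Let dh q : {additive C q -> C q} :=
  match q return {additive C q -> C q} with
  | 0 => aug_d | q'.+1 => @cech_d (gode_iter F q') end.

Let dv q : {additive C q -> C q.+1} :=
  match q return {additive C q -> C q.+1} with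
  | 0 => aug_v | q'.+1 => @cech_v (gode_iter F q') end.

Lemma cech_edges j :
  subquot_iso (fun a : cech (gode_iter F j) => cech_gr 0 a /\ cech_v a = 0)
    (fun a => exists2 b, gr (q := j) 0 b & dv j b = a)
    (fun e : aug => aug_gr j.+1 e /\ aug_d e = 0)
    (fun e => exists2 b, aug_gr j b & aug_d b = e).
Proof.
apply: (@double_complex_edges C gr dh dv).
- by case=> [|q] p x y; [exact: aug_grB|exact: cech_grB].
- by case=> [|q] p x; [exact: aug_gr_d|exact: cech_gr_d].
- by case=> [|q] p x; [exact: aug_gr_v|exact: cech_gr_v].
- by case=> [|q] p x _; [exact: aug_dd|exact: cech_dd].
- by case=> [|q] p x _; [exact: aug_vv|exact: cech_vv].
- by case=> [|q] p x gx; [exact: aug_vd gx|exact: cech_vd].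
- by move=> q x; exact: cech_row_inj.
- by move=> q p x; exact: cech_row_exact.
- by move=> p x; exact: aug_col_inj.
- by case=> [|q] p x; [exact: aug_col_exact|exact: cech_col_exact].
Qed.

(* [gode_cochain F j] is the degree-[0] part of [cech (gode_iter F j)]: [U set0 = X]. *)
Definition global_part (G : presheaf X) (c : cech G) : gode G (opensT X) :=
  fun x => c (val x) finset.set0.

Lemma global_part_is_additive G : zmod_morphism (@global_part G).
Proof. by []. Qed.
HB.instance Definition _ (G : presheaf X) :=
  GRing.isZmodMorphism.Build (cech G) (gode G (opensT X)) (@global_part G)
    (@global_part_is_additive G).

Lemma U0 x : opens_set (U finset.set0) x.
Proof. by apply/UP; exact: finset.sub0set. Qed.

Lemma global_part_v G (c : cech G) :
  global_part (cech_v c) = gode_unit (coker_pi (global_part c) : gode_coker G (opensT X)).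
Proof.
apply: functional_extensionality_dep => x; rewrite /global_part /cech_v (germ0E (U0 _)).
(* [U set0] and [opensT X] have the same points but are different records; restriction passes from
   one to the other. *)
have h : U finset.set0 `<=` opensT X by [].
rewrite (_ : cech_sec c finset.set0 = pres (gode G) h (global_part c)) //.
rewrite -coker_resE /gode_unit.
exact: (@germ_pres _ (gode_coker G)).
Qed.

Lemma global_part_surj G (s : gode G (opensT X)) :
  exists2 c : cech G, cech_gr 0 c & global_part c = s.
Proof.
exists (fun x (H : {set V}) => if H == finset.set0 then s (SigSub (mem_set Logic.I)) else 0).
  move=> x H; case: (H =P finset.set0) => // ->.
  by rewrite finset.cards0 eqxx finset.sub0set.
apply: functional_extensionality_dep => -[x hx]; rewrite /global_part /= eqxx.
by congr (s (exist _ _ _)); exact: bool_irrelevance.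
Qed.

Lemma global_part_inj G (c c' : cech G) : cech_gr 0 c -> cech_gr 0 c' ->
  global_part c = global_part c' -> c = c'.
Proof.
move=> gc gc' e; apply: functional_extensionality_dep => x.
apply: functional_extensionality_dep => H.
have [|h] := boolP (#|H| == 0%N); last by rewrite gc ?gc' ?negb_and ?h.
rewrite cards_eq0 => /eqP ->.
exact: (congr1 (fun s : gode G (opensT X) => s (SigSub (mem_set Logic.I))) e).
Qed.

Theorem cohomology_cone_cover j :
  subquot_iso (fun _ : presheaf_cohomology F j => True) (fun h => h = 0)
    (fun e : aug => aug_gr j.+1 e /\ aug_d e = 0)
    (fun e => exists2 b, aug_gr j b & aug_d b = e).
Proof.
apply: subquot_iso_trans (cech_edges j).
  by move=> x y [gx ex] [gy ey]; split; [exact: cech_grB|rewrite raddfB /= ex ey subrr].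
(* Cycles are compared once for all degrees; boundaries are left open, since the definition of
   cohomology treats degree 0 apart. *)
have glob (I I' : _ -> Prop) :
    (forall a : cech (gode_iter F j), cech_gr 0 a -> (I (global_part a) <-> I' a)) ->
    subquot_iso (fun s => gode_d (F := F) (n := j) s = 0) I
      (fun a : cech (gode_iter F j) => cech_gr 0 a /\ cech_v a = 0) I'.
  move=> II; exists (fun s a => global_part a = s); split.
  - by move=> s a s' a' <- <-; rewrite raddfB.
  - move=> s ds; have [a ga e] := global_part_surj s; exists a => //; split=> //.
    apply: global_part_inj; [exact: cech_gr_v| by move=> *|].
    by rewrite global_part_v e raddf0.
  - move=> a [ga da]; exists (global_part a) => //.
    by rewrite /gode_d -global_part_v da raddf0.
  - by move=> s a ds [ga da] <-; exact: II.
case: j glob => [|j] glob.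
  apply: (subquot_iso_trans _ (subquot_iso_homology _ _)).
    by move=> x y ex ey; rewrite raddfB /= ex ey subrr.
  (* In degree 0 both groups of boundaries vanish: the incoming map is zero on one side, and the
     empty set contains no [v] on the other. *)
  apply: glob => a ga; split=> [[b e]|[b gb e]].
    exists 0; first by move=> *.
    rewrite raddf0; apply: global_part_inj => //; by rewrite -e raddf0.
  exists 0; rewrite -e (_ : b = 0) ?raddf0 //.
  apply: functional_extensionality_dep => H; apply: functional_extensionality_dep => v.
  apply: gb; rewrite cards_eq0; apply/negP => /and3P[/eqP-> _].
  by rewrite inE.
apply: (subquot_iso_trans _ (subquot_iso_homology _ _)).
  by move=> x y ex ey; rewrite raddfB /= ex ey subrr.
apply: glob => a ga; split=> [[s e]|[b gb <-]].
  have [b gb eb] := global_part_surj s; exists b => //.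
  apply: global_part_inj => //; first exact: cech_gr_v.
  by rewrite /= global_part_v eb.
exists (global_part b); exact/esym/global_part_v.
Qed.

End ConeCover.

(** * Cohomology of links *)

Lemma subquot_iso_map (A B : zmodType) (h : {additive A -> B}) (Z I : A -> Prop)
    (Z' I' : B -> Prop) :
  (forall x, Z x -> Z' (h x)) -> (forall y, Z' y -> exists2 x, Z x & h x = y) ->
  (forall x, Z x -> (I x <-> I' (h x))) -> subquot_iso Z I Z' I'.
Proof.
move=> hZ hsurj hI; exists (fun x y => h x = y); split=> //.
- by move=> x y x' y' <- <-; rewrite raddfB.
- by move=> x /hZ; exists (h x).
- by move=> x y Zx _ <-; exact: hI.
Qed.

Lemma subquot_iso_dprod (T : Type) (A B : T -> zmodType) (Z I : forall i, A i -> Prop)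
    (Z' I' : forall i, B i -> Prop) :
  (forall i, subquot_iso (@Z i) (@I i) (@Z' i) (@I' i)) ->
  subquot_iso (fun f : dprod A => forall i, Z i (f i)) (fun f : dprod A => forall i, I i (f i))
    (fun f : dprod B => forall i, Z' i (f i)) (fun f : dprod B => forall i, I' i (f i)).
Proof.
move=> ZI; pose R i := projT1 (cid (ZI i)).
have RP i : [/\ forall x y x' y', R i x y -> R i x' y' -> R i (x - x') (y - y'),
    forall x, Z i x -> exists2 y, Z' i y & R i x y,
    forall y, Z' i y -> exists2 x, Z i x & R i x y &
    forall x y, Z i x -> Z' i y -> R i x y -> (I i x <-> I' i y)] by exact: projT2 (cid (ZI i)).
exists (fun f g => forall i, R i (f i) (g i)); split.
- by move=> f g f' g' h h' i; have [Rsub _ _ _] := RP i; exact: Rsub.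
- move=> f Zf.
  have /all_sig[g gP] i : {y | Z' i y /\ R i (f i) y}.
    by apply: cid; have [_ Rl _ _] := RP i; have [y] := Rl _ (Zf i); exists y.
  by exists g => i; have [] := gP i.
- move=> g Zg.
  have /all_sig[f fP] i : {x | Z i x /\ R i x (g i)}.
    by apply: cid; have [_ _ Rr _] := RP i; have [x] := Rr _ (Zg i); exists x.
  by exists f => i; have [] := fP i.
- move=> f g Zf Zg fg; split=> h i; have [_ _ _ RI] := RP i.
    exact/(RI _ _ (Zf i) (Zg i) (fg i)).
  exact/(RI _ _ (Zf i) (Zg i) (fg i)).
Qed.

Section LinkCochains.
Variables (V : finType) (D : {set {set V}}).
Hypothesis D_sub : forall F G : {set V}, F \in D -> G \subset F -> G \in D.

Definition link_cochains (k : int) : zmodType := dprod (fun v : V => cochain (link D v) k).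

(** The pair of [v |: G] and [v] becomes the face [G] of the link; the sign records the position of
    [v], so that the differentials agree up to a global sign. *)
Definition to_link k (e : aug V) : link_cochains k :=
  fun v => [ffun G : face (link D v) k => e (v |: val G)%SET v * face_sign (v |: val G)%SET v].

Lemma to_link_is_additive k : zmod_morphism (to_link k).
Proof.
move=> e e'; apply: functional_extensionality_dep => v; apply/ffunP => G.
by rewrite !ffunE mulrBl.
Qed.
HB.instance Definition _ k := GRing.isZmodMorphism.Build (aug V) (link_cochains k)
  (to_link k) (to_link_is_additive k).

Definition link_d (k k' : int) (c : link_cochains k) : link_cochains k' :=
  fun v => coboundary k' (c v).

Lemma face_link k v (G : face (link D v) k) :
  [/\ v \notin val G, (v |: val G)%SET \in D & #|val G|%:Z = k + 1].
Proof. by case: G => G /= /andP[]; rewrite inE => /andP[-> ->] /eqP. Qed.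

(** Here [p] is [k + 2]: a face of dimension [k] has [k + 1] vertices, and adjoining [v] adds
    one. *)
Lemma to_link_surj (p : nat) (k : int) (c : link_cochains k) : p%:Z = k + 1 + 1 ->
  exists2 e, aug_gr D p e & to_link k e = c.
Proof.
move=> pk; pose e : aug V := fun H v => if v \in H then
  oapp (c v) 0 (insub (H :\ v)%SET) * face_sign H v else 0.
exists e.
  move=> H v; rewrite /e; case: ifP => // vH; rewrite andbT; case: insubP => [G|]; last first.
    by rewrite mul0r.
  move=> _ GE; have [_ GD cG] := face_link G; move: GD cG; rewrite GE finset.setD1K // => -> cG.
  suff -> : #|H| == p by [].
  by rewrite -eqz_nat pk -cG (cardsD1 v) vH addrC eqxx.
apply: functional_extensionality_dep => v; apply/ffunP => G; rewrite ffunE /e.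
have [vG _ _] := face_link G.
by rewrite finset.setU11 finset.setU1K // valK -mulrA face_sign_sqr mulr1.
Qed.

Lemma to_link_inj (p : nat) (k : int) (e : aug V) : p%:Z = k + 1 + 1 ->
  aug_gr D p e -> to_link k e = 0 -> e = 0.
Proof.
move=> pk ge e0; apply: functional_extensionality_dep => H.
apply: functional_extensionality_dep => v.
have [/and3P[/eqP cH HD vH]|] := boolP [&& #|H| == p, H \in D & v \in H]; last exact: ge.
have fG : ((H :\ v)%SET \in link D v) && (#|(H :\ v)%SET|%:Z == k + 1).
  rewrite inE finset.setD11 finset.setD1K // HD /=.
  by rewrite -(inj_eq (addIr 1)) -pk -cH (cardsD1 v H) vH PoszD addrC.
have := congr1 (fun c : link_cochains k => c v (Sub (H :\ v)%SET fG) * face_sign H v) e0.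
by rewrite ffunE /= finset.setD1K // -mulrA face_sign_sqr mulr1 ffunE mul0r.
Qed.

(** Keeping [k'] as a variable with an equation covers both the step from [k - 1] to [k] and that
    from [k] to [k + 1]. The minus sign is that of [face_sign_link]. *)
Lemma to_link_d (p : nat) (k k' : int) (e : aug V) : k' = k + 1 -> aug_gr D p e ->
  to_link k' (aug_d D e) = - link_d k' (to_link k e).
Proof.
move=> kk' ge; apply: functional_extensionality_dep => v; apply/ffunP => G.
have [vG GD cG] := face_link G; rewrite !ffunE /aug_d GD.
rewrite -[X in X * _]/(eval_at v _) raddf_sum (bigD1 v) ?finset.setU11 //=.
(* The summand removing [v] is zero, as it evaluates [e] at [v] on the set [G], which does not
   contain [v]. *)
rewrite [X in X + _](_ : _ = 0); last first.
  by rewrite raddfMz finset.setU1K // /= /eval_at (aug_supp ge vG) mul0rz.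
rewrite add0r mulr_suml -sumrN; apply: eq_big => [w|w].
  by rewrite !inE; case: eqVneq => [->|]; rewrite ?andbF ?andbT ?(negbTE vG).
rewrite !inE => /andP[]; case: eqVneq => //= wv wG _.
have EG : (v |: (sval G :\ w))%SET = ((v |: sval G) :\ w)%SET.
  rewrite finset.setDUl (_ : [set v]%SET :\ w = [set v])%SET //.
  by apply/finset.setP => u; rewrite !inE; case: (u =P v) => [->|]; rewrite ?andbF // eq_sym wv.
have fG : ((sval G :\ w)%SET \in link D v) && (#|(sval G :\ w)%SET|%:Z == k + 1).
  rewrite inE !inE (negbTE vG) andbF /= EG (D_sub GD (finset.subsetDl _ _)) /=.
  have := etrans cG (congr1 (fun i => i + 1) kk').
  by rewrite (cardsD1 w (sval G)) wG PoszD addrC => /addIr ->.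
rewrite (insubT (fun F : {set V} => (F \in link D v) && (#|F|%:Z == k + 1)) fG) /= ffunE /= EG
  raddfMz /eval_at -mulrzr intz.
rewrite -mulrA [in RHS]mulrCA -mulrN; congr (_ * _).
exact: face_sign_link.
Qed.

(** In the relevant degrees [to_link] is bijective and commutes with the differentials up to -1,
    which affects neither kernels nor images; homology of the product of the link complexes is then
    taken componentwise. *)
Lemma link_cohomology (p : nat) (k : int) : p%:Z = k + 1 ->
  subquot_iso (fun e : aug V => aug_gr D p.+1 e /\ aug_d D e = 0)
    (fun e => exists2 b, aug_gr D p b & aug_d D b = e)
    (fun _ : direct_sum (fun v => reduced_cohomology (link D v) k) => True)
    (fun h => h = 0).
Proof.
move=> pk; have pk0 : p%:Z = k - 1 + 1 + 1 by rewrite subrK.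
have pk1 : p.+1%:Z = k + 1 + 1 by rewrite -pk -addn1 PoszD.
have pk2 : p.+2%:Z = k + 1 + 1 + 1 by rewrite -pk1 -addn1 PoszD.
apply: (@subquot_iso_trans _ (link_cochains k) _ _ _
  (fun c : link_cochains k => forall v, coboundary (k + 1) (c v) = 0)
  (fun c : link_cochains k => forall v,
    exists b : cochain (link D v) (k - 1), coboundary k b = c v)).
- by move=> x y ex ey v; rewrite [(x - y) v](_ : _ = x v - y v) // raddfB /= ex ey subrr.
- apply: (subquot_iso_map (h := to_link k)).
  + move=> e [ge de] v.
    have := to_link_d (erefl (k + 1)) ge; rewrite de raddf0 => /esym/eqP.
    rewrite oppr_eq0 => /eqP e0.
    exact: (congr1 (fun c : link_cochains (k + 1) => c v) e0).
  + move=> c dc; have [e ge ec] := to_link_surj c pk1; exists e => //; split=> //.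
    apply: (to_link_inj pk2); first exact: aug_gr_d.
    rewrite (to_link_d (erefl (k + 1)) ge) ec; apply/eqP; rewrite oppr_eq0; apply/eqP.
    by apply: functional_extensionality_dep => v; exact: dc.
  + move=> e [ge de]; split=> [[b gb <-] v|eb].
      exists (- to_link (k - 1) b v).
      by rewrite /= (to_link_d (k := k - 1) _ gb) ?subrK // raddfN.
    have /all_sig[c ec] v : {b : cochain (link D v) (k - 1) | coboundary k b = - to_link k e v}.
      by apply: cid; have [b <-] := eb v; exists (- b); rewrite raddfN.
    have [b gb bc] := to_link_surj (c : link_cochains (k - 1)) pk0; exists b => //.
    apply/eqP; rewrite -subr_eq0; apply/eqP; apply: (to_link_inj pk1).
      by apply: aug_grB => //; exact: aug_gr_d.
    rewrite raddfB /= (to_link_d (k := k - 1) _ gb) ?subrK // bc.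
    apply: functional_extensionality_dep => v.
    rewrite [LHS](_ : _ = - coboundary k (c v) - to_link k e v) // ec opprK subrr //.
- apply: subquot_iso_sym.
  have iso v := subquot_iso_homology (@coboundary V (link D v) (k - 1) k)
    (@coboundary V (link D v) k (k + 1)).
  have [R [Rsub Rl Rr RI]] := subquot_iso_dprod iso.
  exists R; split=> //.
  - by move=> x _; exact: (Rl x).
  - by move=> y Zy; have [x _ Rxy] := Rr y Zy; exists x.
  - move=> x y _ Zy Rxy; rewrite -(RI x y) //; split=> [-> //|x0].
    exact: functional_extensionality_dep.
Qed.

End LinkCochains.

(** * The spectrum of a simplicial binoid *)

Section SimplicialBinoidUnits.
Variables (V : finType) (D : {set {set V}}).
Hypothesis hD : simplicial_complex D.

Let M : binoidType := simplicial_binoid D.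

Definition supp (a : {ffun V -> nat}) : {set V} := [set v | a v != 0%N]%SET.

Lemma suppD (a b : {ffun V -> nat}) : supp (a + b) = (supp a :|: supp b)%SET.
Proof. by apply/finset.setP => v; rewrite !inE ffunE [(_ + _)%R]/(_ + _)%N addn_eq0 negb_and. Qed.

Definition monomial (a : {ffun V -> nat}) : M := sb_pi D (Some a).

Lemma monomial_is_additive : nmod_morphism monomial.
Proof. by split=> // a b; rewrite /monomial [RHS]sb_piD. Qed.
HB.instance Definition _ := GRing.isNmodMorphism.Build {ffun V -> nat} M monomial
  monomial_is_additive.

Definition var (v : V) : M := monomial [ffun w => (w == v) : nat].

Lemma monomial_sum a : monomial a = \sum_v var v *+ a v.
Proof.
rewrite {1}(_ : a = \sum_v [ffun w => (w == v) : nat] *+ a v).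
  by rewrite raddf_sum; apply: eq_bigr => v _; rewrite raddfMn.
apply/ffunP => w; rewrite sum_ffunE (bigD1 w) //= big1 ?addr0.
  by rewrite ffunMnE ffunE eqxx /=; elim: (a w) => // n IH; rewrite mulrS -[in RHS]IH.
move=> v vw; rewrite ffunMnE ffunE eq_sym (negbTE vw).
by elim: (a v) => // n IH; rewrite mulrS IH.
Qed.

Definition degenerate (a : free_binoid V) : Prop := if a is Some x then supp x \notin D else True.

(* Only [degenerate] words are identified, and these all become [infty]. *)
Lemma sb_pi_eq (a b : free_binoid V) :
  sb_pi D a = sb_pi D b -> a = b \/ degenerate a /\ degenerate b.
Proof.
(* The generated congruence lies in every congruence containing the generators; the relation tested
   is a congruence because adding a word can only enlarge the support. *)
move=> /sb_piP /(_ (fun a b => a = b \/ degenerate a /\ degenerate b)); apply=> [|H HD].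
  split=> [a'|a' b'|a' b' c'|a' b' c'].
  - by left.
  - by case=> [->|[? ?]]; [left|right].
  - by move=> [->|[? ?]] [<-|[? ?]]; [left|right|right|right].
  - have dD x : degenerate x -> degenerate (x + c').
      case: x => [x|]; case: c' => [c|] //= xD; rewrite suppD; apply: contra xD => h.
      exact: (hD.1 _ _ h (finset.subsetUl _ _)).
    by move=> [->|[da db]]; [left|right; split; exact: dD].
right; split=> //.
suff -> : \sum_(v in H) fb_gen v = Some [ffun v => (v \in H) : nat].
  rewrite /= (_ : supp _ = H) //; apply/finset.setP => v; rewrite !inE ffunE.
  by case: (v \in H).
have someD (x y : {ffun V -> nat}) : (Some (x + y) : free_binoid V) =
    (Some x : free_binoid V) + (Some y : free_binoid V) by [].
have -> : \sum_(v in H) fb_gen v =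
    (Some (\sum_(v in H) [ffun w => (w == v) : nat]) : free_binoid V).
  by rewrite (big_morph (fun x : {ffun V -> nat} => Some x : free_binoid V) someD (erefl _)).
congr Some; apply/ffunP => w; rewrite sum_ffunE ffunE.
rewrite (eq_bigr (fun v => (w == v) : nat)); last by move=> v _; rewrite ffunE.
have [wH|wH] := boolP (w \in H).
  rewrite (bigD1 w) //= eqxx big1 ?addr0 // => v /andP[_ vw].
  by rewrite eq_sym (negbTE vw).
by rewrite big1 // => v vH; case: eqP => // wv; rewrite wv vH in wH.
Qed.

Lemma monomial_eq a (b : free_binoid V) : supp a \in D -> sb_pi D b = monomial a -> b = Some a.
Proof. by move=> aD /sb_pi_eq[//|[_ /=]]; rewrite aD. Qed.

Lemma monomial_inj a b : supp a \in D -> monomial b = monomial a -> b = a.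
Proof. by move=> aD /(monomial_eq aD) []. Qed.

(** A prime misses a sum exactly when it misses every summand, and a monomial is a sum of the
    variables in its support. *)
Lemma prime_monomial (p : spec M) a :
  ~ spec_set p (monomial a) <-> forall v, v \in supp a -> ~ spec_set p (var v).
Proof.
split=> [pa v|h].
  rewrite inE => av pv; apply: pa.
  rewrite monomial_sum (bigD1 v) //= -(prednK (n := a v)) ?lt0n // mulrS.
  by apply/specD; left; apply/specD; left.
rewrite monomial_sum; apply: (big_ind (fun m => ~ spec_set p m)).
- exact: spec0.
- by move=> m n pm pn /specD[].
- move=> v _; have [->|av] := eqVneq (a v) 0%N; first by rewrite mulr0n; exact: spec0.
  elim: (a v) => [|n IH]; first exact: spec0.
  by rewrite mulrS => /specD[]; [apply: h; rewrite inE|].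
Qed.

Definition indicator (H : {set V}) : {ffun V -> nat} := [ffun v => (v \in H) : nat].

Lemma supp_indicator H : supp (indicator H) = H.
Proof. by apply/finset.setP => v; rewrite inE ffunE; case: (v \in H). Qed.

Lemma monomial_indicator (H : {set V}) : H \notin D -> monomial (indicator H) = infty.
Proof.
move=> HD; rewrite monomial_sum.
transitivity (\sum_(v in H) var v).
  by rewrite [RHS]big_mkcond; apply: eq_bigr => v _; rewrite ffunE; case: (v \in H).
have /sb_piP e : sb_rel D (\sum_(v in H) fb_gen v) infty by move=> R _; exact.
apply: etrans e.
have sbD : {morph sb_pi D : a b / a + b >-> (a + b : M)} by move=> a b; rewrite -sb_piD.
by rewrite (big_morph _ sbD (erefl _)).
Qed.

(** * Primes attached to faces, the focal points of the stars *)

Section FacePrime.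
Variable H : {set V}.
Hypothesis HD : H \in D.

(** The ideal generated by the variables outside [H], given through its complement, the monoid of
    monomials supported on [H]. *)
Definition face_set : set M := [set m | ~ exists2 a, supp a \subset H & m = monomial a].

Lemma face_setPn m : ~ face_set m <-> exists2 a, supp a \subset H & m = monomial a.
Proof. by split=> [/contrapT|h /(_ h)]. Qed.

Lemma monomial_face a : supp a \subset H -> supp a \in D.
Proof. exact: hD.1. Qed.

Lemma face_set_prime : is_prime face_set.
Proof.
split.
- split; first by move=> [a aH e]; have := monomial_eq (monomial_face aH) e.
  move=> m n hn [c cH e]; apply: hn; move: e.
  rewrite -(sb_piK m) -(sb_piK n); set a := repr m; set b := repr n.
  (* As [c] is supported on a face, no identification occurs and the words themselves are equal, so
     supports can be compared. *)
  rewrite [LHS]sb_piD => /(monomial_eq (monomial_face cH)).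
  case: a => [a|]; case: b => [b|] //= -[abc]; exists b => //.
  by move: cH; rewrite -abc suppD finset.subUset => /andP[].
- move=> e; have h : face_set 0 by rewrite e.
  apply: h; exists 0; last by rewrite raddf0.
  by apply/fintype.subsetP => v; rewrite inE ffunE.
- move=> m n h; apply: contrapT => /not_orP[/face_setPn[a aH em] /face_setPn[b bH en]].
  by apply: h; exists (a + b); rewrite ?suppD ?finset.subUset ?aH // em en raddfD.
Qed.

Definition face_prime : spec M := Spec face_set_prime.

Lemma var_face v : v \in H -> ~ spec_set face_prime (var v).
Proof.
move=> vH; apply/face_setPn; exists [ffun w => (w == v) : nat] => //.
by apply/fintype.subsetP => w; rewrite inE ffunE; case: (w =P v) => // ->.
Qed.

(** A variable indexed by [H] lies outside the prime but is not a unit, since no word containing it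
    is identified with the zero word. *)
Lemma face_prime_punctured : H != finset.set0 -> punctured face_prime.
Proof.
move=> /finset.set0Pn[v vH] e; apply: (var_face vH).
rewrite e => -[m]; rewrite -(sb_piK m) [LHS]sb_piD => /esym h.
have h' : sb_pi D ((Some [ffun w => (w == v) : nat] : free_binoid V) + repr m) = monomial 0.
  exact/esym.
have D0 : supp 0 \in D.
  rewrite (_ : supp 0 = finset.set0); first exact: (hD.1 _ _ HD (finset.sub0set _)).
  by apply/finset.setP => w; rewrite !inE ffunE.
have := monomial_eq D0 h'; case: (repr m) => [x|] //= -[/ffunP/(_ v)].
by rewrite !ffunE eqxx.
Qed.

End FacePrime.

Let X : topologicalType := set_type (@punctured M).
Let F : sheaf X := punctured_units M.

Definition invertible_vars (x : X) : {set V} := [set v | `[< ~ spec_set (val x) (var v) >]]%SET.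

Lemma star_open (H : {set V}) :
  open [set x : X | basicD (monomial (indicator H)) (val x)].
Proof. by exists (basicD (monomial (indicator H))); [exact: basicD_open|]. Qed.

Definition star (H : {set V}) : opens X := Opens (star_open H).

Lemma starP (H : {set V}) (x : X) : opens_set (star H) x <-> H \subset invertible_vars x.
Proof.
rewrite /= /basicD /= prime_monomial supp_indicator; split=> [h|/fintype.subsetP h v vH].
  by apply/fintype.subsetP => v vH; rewrite inE; apply/asboolP; exact: h.
by have := h v vH; rewrite inE => /asboolP.
Qed.

(** A prime containing every variable contains every nonunit, so it is the maximal ideal, which the
    punctured spectrum omits. *)
Lemma invertible_vars_neq0 (x : X) : invertible_vars x != finset.set0.
Proof.
apply/negP => /eqP x0; have /set_mem px := valP x; apply: px; apply/seteqP.
split; first exact: prime_sub_nonunits.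
have xv v : spec_set (val x) (var v).
  apply: contrapT => h; have : v \in finset.set0 by rewrite -x0 inE; apply/asboolP.
  by rewrite inE.
have [[xinfty _] _ _] := specP (val x).
move=> m; rewrite -(sb_piK m); case: (repr m) => [a|] // um.
have [a0|[v av]] := @finset.set_0Vmem _ (supp a).
  case: um; exists 0; rewrite addr0 -[RHS](raddf0 monomial); congr monomial.
  apply/ffunP => v; rewrite ffunE; apply/eqP; apply: contraT => h.
  have : v \in supp a by rewrite inE.
  by rewrite a0 inE.
by apply: contrapT => /prime_monomial /(_ v av); apply; exact: xv.
Qed.

(** Over a nonface the sum of the variables is [infty], which every prime contains, so one of these
    variables lies in the prime. *)
Lemma invertible_vars_face (x : X) : invertible_vars x \in D.
Proof.
apply: contraT => /monomial_indicator h.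
have /(starP _ x) : invertible_vars x \subset invertible_vars x by [].
by rewrite /= /basicD /= h; case: (specP (val x)) => -[].
Qed.

(** If [D(f)] contains the face prime, then [f] is a monomial supported on [H], and no prime in the
    star of [H] contains it. *)
Lemma face_point_in (H : {set V}) (HD : H \in D) (W : opens X) (y : X) :
  H != finset.set0 -> val y = face_prime HD -> opens_set W y -> star H `<=` W.
Proof.
move=> H0 ey Wy x /starP Hx; have [B oB BW] := opensP W.
have By : B (face_prime HD) by rewrite -ey; move: Wy; rewrite -BW.
have [f [fp fB]] := open_basicD oB By.
rewrite -BW; apply: fB; move: fp => /face_setPn[a aH ->]; apply/prime_monomial => v va.
have := fintype.subsetP Hx v (fintype.subsetP aH v va).
by rewrite inE => /asboolP.
Qed.

Lemma star_focus (H : {set V}) (HD : H \in D) (H0 : H != finset.set0) :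
  exists m : X, [/\ val m = face_prime HD, opens_set (star H) m &
    forall W : opens X, opens_set W m -> star H `<=` W].
Proof.
exists (SigSub (mem_set (face_prime_punctured (HD := HD) H0))); split=> //.
  apply/starP/fintype.subsetP => v vH; rewrite inE; apply/asboolP.
  exact: var_face.
by move=> W; exact: face_point_in.
Qed.

(** * Units over a star *)

Section FractionSection.
Variables (W : opens (spec M)) (f : M).
Hypothesis Wf : W `<=` basicD f.

Lemma numerator_is_section :
  is_section (fun p (pW : opens_set W p) => mkfrac f (rpred0 (outside p)) : loc_at_prime p).
Proof.
apply/is_sectionP => p pW; exists f, 0; split; first exact: spec0.
by move=> q q0 qW; apply/mkfracP; exists 0; rewrite ?rpred0.
Qed.

Lemma denominator_is_section :
  is_section (fun p (pW : opens_set W p) => mkfrac 0 (outsideP (Wf pW)) : loc_at_prime p).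
Proof.
apply/is_sectionP => p pW; exists 0, f; split; first exact: Wf.
by move=> q q0 qW; apply/mkfracP; exists 0; rewrite ?rpred0.
Qed.

Lemma numerator_is_unit : is_unit (SectionOf numerator_is_section).
Proof.
exists (SectionOf denominator_is_section); apply: sections_eq => p pW /=.
rewrite [LHS](mkfracD _ _ _ _ (rpredD (rpred0 (outside p)) (outsideP (Wf pW)))).
by apply/mkfracP; exists 0; rewrite ?rpred0 // !addr0 !add0r.
Qed.

Definition unit_section : unit_group (sections W) := UnitElt numerator_is_unit.

End FractionSection.

(** The default 0 makes this total in [v]; the computations below use exponents that vanish wherever
    it is taken. *)
Definition var_section (W : opens (spec M)) v : unit_group (sections W) :=
  if pselect (W `<=` basicD (var v)) is left h then unit_section h else 0.

Lemma var_sectionE (W : opens (spec M)) v (h : W `<=` basicD (var v)) :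
  var_section W v = unit_section h.
Proof. by rewrite /var_section; case: pselect => // h'; rewrite (Prop_irrelevance h' h). Qed.

(** The Laurent monomial with exponent vector [e]. *)
Definition vars_section (W : opens (spec M)) (e : dprod (fun _ : V => int)) :
  unit_group (sections W) := \sum_v var_section W v *~ e v.

Lemma vars_section_is_additive W : zmod_morphism (vars_section W).
Proof.
move=> e e'; rewrite /vars_section -sumrB; apply: eq_bigr => v _.
by rewrite -mulrzBr.
Qed.
HB.instance Definition _ W := GRing.isZmodMorphism.Build (dprod (fun _ : V => int))
  (unit_group (sections W)) (vars_section W) (vars_section_is_additive W).

Definition to_loc (p : spec M) (m : M) : loc_at_prime p := mkfrac m (rpred0 (outside p)).

Lemma to_loc_is_additive p : nmod_morphism (to_loc p).
Proof.
split=> // m n; rewrite /to_loc.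
rewrite [RHS](mkfracD _ _ _ _ (rpredD (rpred0 (outside p)) (rpred0 (outside p)))).
by apply/mkfracP; exists 0; rewrite ?rpred0 // !addr0.
Qed.
HB.instance Definition _ p := GRing.isNmodMorphism.Build M (loc_at_prime p) (to_loc p)
  (to_loc_is_additive p).

Definition value_at (W : opens (spec M)) p (pW : opens_set W p) (s : unit_group (sections W)) :
  loc_at_prime p := sec_val (unit_val s) pW.

Lemma value_at_is_additive W p (pW : opens_set W p) : nmod_morphism (value_at pW).
Proof. by []. Qed.
HB.instance Definition _ W p (pW : opens_set W p) :=
  GRing.isNmodMorphism.Build (unit_group (sections W)) (loc_at_prime p) (value_at pW)
    (value_at_is_additive pW).

Definition exponents (a : {ffun V -> nat}) : dprod (fun _ : V => int) := fun v => (a v)%:Z.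

Lemma value_at_monomial (W : opens (spec M)) p (pW : opens_set W p) a :
  W `<=` basicD (monomial a) -> value_at pW (vars_section W (exponents a)) = to_loc p (monomial a).
Proof.
move=> Wa; rewrite monomial_sum /vars_section !raddf_sum; apply: eq_bigr => v _.
rewrite [LHS]raddfMn [RHS]raddfMn.
have [->|av] := eqVneq (a v) 0%N; first by rewrite !mulr0n.
have Wv : W `<=` basicD (var v).
  by move=> q /Wa /prime_monomial; apply; rewrite inE.
by rewrite var_sectionE.
Qed.

(** The localization at a prime is only a monoid, so values are compared for nonnegative exponents
    and [e] is split into a difference. *)
Definition pos_part (e : dprod (fun _ : V => int)) : {ffun V -> nat} :=
  [ffun v => if e v is Posz n then n else 0%N].
Definition neg_part (e : dprod (fun _ : V => int)) : {ffun V -> nat} :=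
  [ffun v => if e v is Negz n then n.+1 else 0%N].

Lemma exponentsE e : e = exponents (pos_part e) - exponents (neg_part e).
Proof.
apply: functional_extensionality_dep => v.
rewrite [RHS](_ : _ = (pos_part e v)%:Z - (neg_part e v)%:Z) // !ffunE.
by case: (e v) => n; rewrite ?subr0 ?sub0r ?NegzE.
Qed.

(** Sections of the restricted sheaf over [star H] are by definition those over this open of the
    full spectrum. *)
Definition star_image (H : {set V}) : opens (spec M) :=
  @opens_image (spec M) (punctured_opens M) (star H).

Lemma star_monomial (H : {set V}) a : supp a \subset H ->
  star_image H `<=` basicD (monomial a).
Proof.
move=> aH p [y /starP Hy <-]; apply/prime_monomial => v va.
have := fintype.subsetP Hy v (fintype.subsetP aH v va).
by rewrite inE => /asboolP.
Qed.

Definition theta (H : {set V}) : {additive dprod (fun _ : V => int) -> F (star H)} :=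
  vars_section (star_image H).

Lemma theta_res (H K : {set V}) (h : star H `<=` star K) (e : dprod (fun _ : V => int)) :
  K \subset H -> (forall v, v \notin K -> e v = 0) -> pres F h (theta K e) = theta H e.
Proof.
move=> KH e0; rewrite /theta /= /vars_section raddf_sum; apply: eq_bigr => v _.
have [vK|vK] := boolP (v \in K); last by rewrite e0 // !mulr0z raddf0.
have sv : supp [ffun w => (w == v) : nat] \subset K.
  by apply/fintype.subsetP => w; rewrite inE ffunE; case: (w =P v) => // ->.
rewrite raddfMz (var_sectionE (star_monomial sv)).
rewrite (var_sectionE (star_monomial (fintype.subset_trans sv KH))); congr (_ *~ _).
by apply: unit_val_inj; apply: sections_eq.
Qed.

(** At the focal point the two parts of [e] give equal fractions. The element [c] witnessing this
    lies outside the prime, so it is a monomial supported on [H]; words supported on a face are not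
    identified, and [c] cancels. *)
Lemma theta_inj (H : {set V}) (e : dprod (fun _ : V => int)) : H \in D ->
  H != finset.set0 -> (forall v, v \notin H -> e v = 0) -> theta H e = 0 -> e = 0.
Proof.
move=> HD H0 e0; have [m [em Hm _]] := star_focus HD H0.
have aH : supp (pos_part e) \subset H.
  apply/fintype.subsetP => v; rewrite inE ffunE; apply: contraR => /e0 -> //.
have bH : supp (neg_part e) \subset H.
  apply/fintype.subsetP => v; rewrite inE ffunE; apply: contraR => /e0 -> //.
rewrite {1}(exponentsE e) raddfB => /eqP; rewrite subr_eq0 => /eqP eab.
have pW : opens_set (star_image H) (val m) by exists m.
have := congr1 (value_at pW) eab.
rewrite !value_at_monomial; try exact: star_monomial.
move=> /mkfracP[u /asboolP]; rewrite em => /face_setPn[c cH ->].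
rewrite !addr0 -!raddfD => /monomial_inj e'.
have /e' /ffunP abc : supp (neg_part e + c) \in D.
  by rewrite suppD; apply: (hD.1 _ _ HD); rewrite finset.subUset bH.
have ab : pos_part e = neg_part e.
  by apply/ffunP => v; have := abc v; rewrite ffunE [RHS]ffunE => /addIn.
by rewrite (exponentsE e) ab subrr.
Qed.

(** Near the focal point [t] is a fraction [a - f]. Both terms lie outside the face prime, hence are
    monomials supported on [H], and their exponents give [e]. *)
Lemma theta_surj (H : {set V}) (t : F (star H)) : H \in D -> H != finset.set0 ->
  exists2 e : dprod (fun _ : V => int), (forall v, v \notin H -> e v = 0) & theta H e = t.
Proof.
move=> HD H0; have [m [em Hm mH]] := star_focus HD H0.
have pW : opens_set (star_image H) (val m) by exists m.
have /is_sectionP/(_ _ pW)[a [f [pf tf]]] := sec_valP (unit_val t).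
have fm := pf; rewrite /basicD /= em in fm; have /face_setPn[b bH fb] := fm.
(* Since [t - t = 0], adding suitable elements to [a] gives a sum of elements outside the prime; so
   [a] is outside as well. *)
have am : ~ spec_set (val m) a.
  have := congr1 (value_at pW) (subrr t); rewrite raddfD /= {1}/value_at (tf _ pf).
  have [c [s [sm ->]]] := mkfrac_surj (value_at pW (- t)).
  rewrite [LHS](mkfracD _ _ _ _ (rpredD (outsideP pf) sm)) => /mkfracP[u um e] am.
  have : spec_set (val m) (a + c + 0 + u) by rewrite addr0 -addrA; apply/specD; left.
  rewrite e add0r => /specD[/specD[]|]; [exact: pf|exact/asboolP|exact/asboolP].
rewrite em in am; have /face_setPn[c cH ac] := am.
exists (exponents c - exponents b).
  move=> v vH.
  rewrite [LHS](_ : _ = (c v)%:Z - (b v)%:Z) //.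
  have -> : c v = 0%N.
    by apply/eqP; apply: contraNT vH => h; apply: (fintype.subsetP cH); rewrite inE.
  have -> : b v = 0%N.
    by apply/eqP; apply: contraNT vH => h; apply: (fintype.subsetP bH); rewrite inE.
  by [].
rewrite raddfB; apply/eqP; rewrite subr_eq; apply/eqP.
apply: unit_val_inj; apply: sections_eq => q qW.
(* The whole star lies in [D(f)], so the fraction found at the focal point represents [t] at every
   [q]. *)
have qf : basicD f q by rewrite fb; exact: (star_monomial bH).
have := value_at_monomial qW (star_monomial cH); rewrite {1}/value_at /= => ->.
rewrite [RHS](raddfD (value_at qW)) /= (value_at_monomial qW (star_monomial bH)).
rewrite /value_at (tf q qf) -fb -ac.
rewrite [RHS](mkfracD _ _ _ _ (rpredD (outsideP qf) (rpred0 (outside q)))).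
by apply/mkfracP; exists 0; rewrite ?rpred0 // !addr0.
Qed.

End SimplicialBinoidUnits.

Theorem theorem2p25 (V : finType) (D : {set {set V}}) (hD : simplicial_complex D)
    (j : nat) :
  isomorphic (sheaf_cohomology (punctured_units (simplicial_binoid D)) j)
             (direct_sum (fun v : V => reduced_cohomology (link D v) (j%:Z - 1)%R)).
Proof.
have Dsub (F G : {set V}) : F \in D -> G \subset F -> G \in D by exact: hD.1.
apply: subquot_iso_isomorphic.
have cover : subquot_iso
    (fun _ : presheaf_cohomology (punctured_units (simplicial_binoid D)) j => True)
    (fun h => h = 0) (fun e : aug V => aug_gr D j.+1 e /\ aug_d D e = 0)
    (fun e => exists2 b, aug_gr D j b & aug_d D b = e).
  apply: (@cohomology_cone_cover _ _ V D (@invertible_vars V D) (star D) _ _ _ _ _ (theta D)).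
  - exact: Dsub.
  - exact: starP.
  - exact: invertible_vars_neq0.
  - exact: invertible_vars_face.
  - by move=> H HD H0; have [m [_ ? ?]] := star_focus hD HD H0; exists m.
  - exact: theta_res.
  - exact: (theta_inj hD).
  - exact: (theta_surj hD).
apply: subquot_iso_trans cover _.
  by move=> x y [gx ex] [gy ey]; split; [exact: aug_grB|rewrite raddfB /= ex ey subrr].
(* Of the [j + 1] elements of [H] one is [v]; the other [j] form a face of dimension [j - 1]. *)
by apply: link_cohomology => //; rewrite subrK.
Qed.
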